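(* Let $q\in\mathbb{C}^*$ be not a root of unity, $j_1,j_2\in\frac12\mathbb{N}$, and $a,b,u_1,u_2\in\mathbb{C}^*$ be such that the joint eigenvalues listed in the context are pairwise distinct for each of the six families (so each family is a basis of $\mathbb{C}_{2j_1}[z_1]\otimes\mathbb{C}_{2j_2}[z_2]$) and such that the coefficients below are well defined (no vanishing denominators). The overlap coefficients between the polynomial eigenbases of the pairs $(\mathcal{A}_2,\mathcal{A}_{12})$, $(\mathcal{B}_1,\mathcal{B}_{12})$, $(\mathcal{A}_1,\mathcal{A}_{21})$, $(\mathcal{B}_2,\mathcal{B}_{21})$ are as follows: for all $0\le k_1\le 2j_1$, $0\le k_2\le 2j_2$, $$\mathfrak{w}_{k_1,k_2}=\sum_{\ell_1=0}^{2j_1}\sum_{\ell_2=0}^{2j_2}T_{k_1,k_2}(\ell_1,\ell_2)\,\mathfrak{u}_{\ell_1,\ell_2},\qquad \overline{\mathfrak{w}}_{k_1,k_2}=\sum_{\ell_1=0}^{2j_1}\sum_{\ell_2=0}^{2j_2}S_{k_1,k_2}(\ell_1,\ell_2)\,\mathfrak{u}_{\ell_1,\ell_2},$$ $$\overline{\mathfrak{w}}_{k_1,k_2}=\sum_{\ell_1=0}^{2j_1}\sum_{\ell_2=0}^{2j_2}\overline{T}_{k_1,k_2}(\ell_1,\ell_2)\,\overline{\mathfrak{u}}_{\ell_1,\ell_2},\qquad \mathfrak{w}_{k_1,k_2}=\sum_{\ell_1=0}^{2j_1}\sum_{\ell_2=0}^{2j_2}\overline{S}_{k_1,k_2}(\ell_1,\ell_2)\,\overline{\mathfrak{u}}_{\ell_1,\ell_2},$$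 where $$T_{k_1,k_2}(\ell_1,\ell_2)=R_{k_1}(\ell_1;aq^{2\ell_2-2j_2},b,u_1,j_1,q)\,R_{k_2}(\ell_2;a,bq^{2k_1-2j_1},u_2,j_2,q),$$ $$S_{k_1,k_2}(\ell_1,\ell_2)=R_{k_1}(\ell_1;aq^{2\ell_2-2j_2},bq^{2k_2-2j_2},u_1,j_1,q)\,R_{k_2}(\ell_2;a,b,u_2,j_2,q),$$ $$\overline{T}_{k_1,k_2}(\ell_1,\ell_2)=R_{k_1}(\ell_1;a,bq^{2k_2-2j_2},u_1,j_1,q)\,R_{k_2}(\ell_2;aq^{2\ell_1-2j_1},b,u_2,j_2,q),$$ $$\overline{S}_{k_1,k_2}(\ell_1,\ell_2)=R_{k_1}(\ell_1;a,b,u_1,j_1,q)\,R_{k_2}(\ell_2;aq^{2\ell_1-2j_1},bq^{2k_1-2j_1},u_2,j_2,q).$$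
   Context: $\mathbb{C}_{2j}[z]$ is the space of polynomials in $z$ of degree at most $2j$. $(z;q)_n=\prod_{k=0}^{n-1}(1-zq^k)$, $(z;q)_0=1$; $(z_1,\dots,z_p;q)_n=\prod_i(z_i;q)_n$; $\left[\begin{smallmatrix}n\\ \ell\end{smallmatrix}\right]_q=\frac{(q;q)_n}{(q;q)_\ell(q;q)_{n-\ell}}$; ${}_4\phi_3\left({q^{-n},a_1,a_2,a_3\atop b_1,b_2,b_3}\big|q,z\right)=\sum_{k=0}^n\frac{(q^{-n},a_1,a_2,a_3;q)_k}{(q,b_1,b_2,b_3;q)_k}z^k$ (in base $q^2$, replace $q$ by $q^2$ throughout). For $0\le k,\ell\le 2j$, $$R_k(\ell;a,b,u,j,q)=q^{2\ell(\ell-2j)}\left[\begin{smallmatrix}2j\\ \ell\end{smallmatrix}\right]_{q^2}\frac{(q^{2-2j}abu^{-2};q^2)_\ell\,(q^{2-2j}a^{-1}bu^{-2};q^2)_{2j-\ell}\,(q^{2+2j-2k}a^{-1}b^{-1}u^{-2};q^2)_k}{(q^{2\ell-4j}a^2;q^2)_\ell\,(q^{-2\ell}a^{-2};q^2)_{2j-\ell}\,(q^{2-2j}a^{-1}bu^{-2};q^2)_k}\;{}_4\phi_3\left({q^{-2k},\,q^{2k-4j}b^2,\,q^{-2\ell},\,q^{2\ell-4j}a^2\atop q^{-4j},\,q^{-2j}abu^2,\,q^{2-2j}abu^{-2}}\Big|q^2,q^2\right).$$ With $p_n(z;a,j,q)=(za;q^2)_n(z/a;q^2)_{2j-n}$,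 define for $0\le n_1\le 2j_1$, $0\le n_2\le 2j_2$: $\mathfrak{u}_{n_1,n_2}=p_{n_1}(z_1u_1q^{-j_1};aq^{2n_2-2j_2},j_1,q)\,p_{n_2}(z_2u_2q^{-j_2};a,j_2,q)$, $\mathfrak{v}_{n_1,n_2}=p_{n_1}(z_1q^{j_1}u_1^{-1};b^{-1},j_1,q^{-1})\,p_{n_2}(z_2u_2q^{-j_2};a,j_2,q)$, $\mathfrak{w}_{n_1,n_2}=p_{n_1}(z_1q^{j_1}u_1^{-1};b^{-1},j_1,q^{-1})\,p_{n_2}(z_2q^{j_2}u_2^{-1};b^{-1}q^{2j_1-2n_1},j_2,q^{-1})$, $\overline{\mathfrak{u}}_{n_1,n_2}=p_{n_1}(z_1u_1q^{-j_1};a,j_1,q)\,p_{n_2}(z_2u_2q^{-j_2};aq^{2n_1-2j_1},j_2,q)$, $\overline{\mathfrak{v}}_{n_1,n_2}=p_{n_1}(z_1u_1q^{-j_1};a,j_1,q)\,p_{n_2}(z_2q^{j_2}u_2^{-1};b^{-1},j_2,q^{-1})$, $\overline{\mathfrak{w}}_{n_1,n_2}=p_{n_1}(z_1q^{j_1}u_1^{-1};b^{-1}q^{2j_2-2n_2},j_1,q^{-1})\,p_{n_2}(z_2q^{j_2}u_2^{-1};b^{-1},j_2,q^{-1})$. Operators on $\mathbb{C}_{2j_1}[z_1]\otimes\mathbb{C}_{2j_2}[z_2]$, with $\alpha=a+a^{-1}$, $\beta=b+b^{-1}$, $T^{(1)}_\pm f(z_1,z_2)=f(q^{\pm1}z_1,z_2)$,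 $T^{(2)}_\pm f(z_1,z_2)=f(z_1,q^{\pm1}z_2)$, $i=1,2$: $\mathcal{A}_i=u_iz_iq^{j_i}+u_i^{-1}z_i^{-1}q^{-j_i}-u_i^{-1}q^{-j_i}z_i^{-1}(1-z_iu_iq^{-j_i}a)(1-z_iu_iq^{-j_i}a^{-1})(T^{(i)}_+)^2$, $\mathcal{B}_i=u_i^{-1}z_iq^{-j_i}+u_iz_i^{-1}q^{j_i}-u_iq^{j_i}z_i^{-1}(1-z_iu_i^{-1}q^{j_i}b)(1-z_iu_i^{-1}q^{j_i}b^{-1})(T^{(i)}_-)^2$, $\mathcal{A}_{12}=\mathcal{A}_1+q^{-2j_1}(T^{(1)}_+)^2(\mathcal{A}_2-\alpha)$, $\mathcal{B}_{12}=\mathcal{B}_2+(\mathcal{B}_1-\beta)q^{2j_2}(T^{(2)}_-)^2$, $\mathcal{A}_{21}=\mathcal{A}_2+(\mathcal{A}_1-\alpha)q^{-2j_2}(T^{(2)}_+)^2$, $\mathcal{B}_{21}=\mathcal{B}_1+q^{2j_1}(T^{(1)}_-)^2(\mathcal{B}_2-\beta)$. With $\theta_c(m)=q^{m}c+q^{-m}c^{-1}$, the joint eigenvalues are: $(\theta_a(2n_2-2j_2),\theta_a(2n_1+2n_2-2j_1-2j_2))$ of $(\mathcal{A}_2,\mathcal{A}_{12})$ on $\mathfrak{u}_{n_1,n_2}$; $(\theta_a(2n_2-2j_2),\theta_b(2n_1-2j_1))$ of $(\mathcal{A}_2,\mathcal{B}_1)$ on $\mathfrak{v}_{n_1,n_2}$;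 $(\theta_b(2n_1-2j_1),\theta_b(2n_1+2n_2-2j_1-2j_2))$ of $(\mathcal{B}_1,\mathcal{B}_{12})$ on $\mathfrak{w}_{n_1,n_2}$; $(\theta_a(2n_1-2j_1),\theta_a(2n_1+2n_2-2j_1-2j_2))$ of $(\mathcal{A}_1,\mathcal{A}_{21})$ on $\overline{\mathfrak{u}}_{n_1,n_2}$; $(\theta_a(2n_1-2j_1),\theta_b(2n_2-2j_2))$ of $(\mathcal{A}_1,\mathcal{B}_2)$ on $\overline{\mathfrak{v}}_{n_1,n_2}$; $(\theta_b(2n_2-2j_2),\theta_b(2n_1+2n_2-2j_1-2j_2))$ of $(\mathcal{B}_2,\mathcal{B}_{21})$ on $\overline{\mathfrak{w}}_{n_1,n_2}$. *)

(* Defs.v *)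
From HB Require Import structures.
From mathcomp Require Import all_boot all_order all_algebra.
From mathcomp Require Import all_real_closed reals.

Set Implicit Arguments.
Unset Strict Implicit.
Unset Printing Implicit Defensive.

Import Order.TTheory GRing.Theory Num.Theory.
Local Open Scope ring_scope.

(* Half-integers j are represented by the natural number N = 2j.  Half-integer
   powers of q are taken with respect to a fixed square root s of q:
   q^j is s ^ N, whereas q^(2j) is q ^ N. *)

Definition qpoch (A : comNzRingType) (z q : A) (n : nat) : A :=
  \prod_(k < n) (1 - z * q ^+ k).

Section Overlap.
Variable F : fieldType.
Implicit Types (a b c q s u : F) (k l m n N : nat).

Definition qbinom_den n l q : F := qpoch q q l * qpoch q q (n - l).
Definition qbinom n l q : F := qpoch q q n / qbinom_den n l q.

(* phi43 n a1 a2 a3 b1 b2 b3 q z is the terminating series whose first upper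
   parameter is q ^ -n. *)
Definition phi43_den b1 b2 b3 q k : F :=
  qpoch q q k * qpoch b1 q k * qpoch b2 q k * qpoch b3 q k.
Definition phi43 n a1 a2 a3 b1 b2 b3 q z : F :=
  \sum_(k < n.+1)
    (qpoch (q ^- n) q k * qpoch a1 q k * qpoch a2 q k * qpoch a3 q k)
    / phi43_den b1 b2 b3 q k * z ^+ k.

Definition Rden k l a b u N q : F :=
  qpoch (q ^ (2 * l%:Z - 2 * N%:Z) * a ^+ 2) (q ^+ 2) l
  * qpoch (q ^ (- 2 * l%:Z) * a ^- 2) (q ^+ 2) (N - l)
  * qpoch (q ^ (2 - N%:Z) * a^-1 * b * u ^- 2) (q ^+ 2) k.

Definition R_ k l a b u N q : F :=
  q ^ (2 * l%:Z * (l%:Z - N%:Z)) * qbinom N l (q ^+ 2)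
  * ((qpoch (q ^ (2 - N%:Z) * a * b * u ^- 2) (q ^+ 2) l
      * qpoch (q ^ (2 - N%:Z) * a^-1 * b * u ^- 2) (q ^+ 2) (N - l)
      * qpoch (q ^ (2 + N%:Z - 2 * k%:Z) * a^-1 * b^-1 * u ^- 2) (q ^+ 2) k)
     / Rden k l a b u N q)
  * phi43 k (q ^ (2 * k%:Z - 2 * N%:Z) * b ^+ 2)
            (q ^ (- 2 * l%:Z))
            (q ^ (2 * l%:Z - 2 * N%:Z) * a ^+ 2)
            (q ^ (- 2 * N%:Z))
            (q ^ (- N%:Z) * a * b * u ^+ 2)
            (q ^ (2 - N%:Z) * a * b * u ^- 2)
            (q ^+ 2) (q ^+ 2).

(* No denominator occurring in R_ vanishes (recall x / 0 = 0 in MathComp). *)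
Definition R_well_defined k l a b u N q : Prop :=
  [/\ qbinom_den N l (q ^+ 2) != 0,
      Rden k l a b u N q != 0
    & forall i, (i <= k)%N ->
        phi43_den (q ^ (- 2 * N%:Z)) (q ^ (- N%:Z) * a * b * u ^+ 2)
                  (q ^ (2 - N%:Z) * a * b * u ^- 2) (q ^+ 2) i != 0].

(* F[z1, z2] is {poly {poly F}}: z1 is the outer variable, z2 the inner one. *)
Definition cst c : {poly {poly F}} := c%:P%:P.
Definition z1 : {poly {poly F}} := 'X.
Definition z2 : {poly {poly F}} := 'X%:P.
Definition bieval (p : {poly {poly F}}) (x y : F) : F := p.[x%:P].[y].

(* F_{N1}[z1] (x) F_{N2}[z2], realised as polynomials of bounded bidegree. *)
Definition tensor_space N1 N2 (p : {poly {poly F}}) : Prop :=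
  (size p <= N1.+1)%N /\ forall i : nat, (size (p`_i)%R <= N2.+1)%N.

Definition p_ n (z : {poly {poly F}}) a N q : {poly {poly F}} :=
  qpoch (z * cst a) (cst (q ^+ 2)) n
  * qpoch (z * cst a^-1) (cst (q ^+ 2)) (N - n).

Section Families.
Variables (q s a b u1 u2 : F) (N1 N2 : nat).

Definition fu (n1 n2 : nat) : {poly {poly F}} :=
  p_ n1 (z1 * cst (u1 * s ^- N1)) (a * q ^ (2 * n2%:Z - N2%:Z)) N1 q
  * p_ n2 (z2 * cst (u2 * s ^- N2)) a N2 q.

Definition fv (n1 n2 : nat) : {poly {poly F}} :=
  p_ n1 (z1 * cst (s ^+ N1 * u1^-1)) b^-1 N1 q^-1
  * p_ n2 (z2 * cst (u2 * s ^- N2)) a N2 q.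

Definition fw (n1 n2 : nat) : {poly {poly F}} :=
  p_ n1 (z1 * cst (s ^+ N1 * u1^-1)) b^-1 N1 q^-1
  * p_ n2 (z2 * cst (s ^+ N2 * u2^-1))
       (b^-1 * q ^ (N1%:Z - 2 * n1%:Z)) N2 q^-1.

Definition fu_bar (n1 n2 : nat) : {poly {poly F}} :=
  p_ n1 (z1 * cst (u1 * s ^- N1)) a N1 q
  * p_ n2 (z2 * cst (u2 * s ^- N2)) (a * q ^ (2 * n1%:Z - N1%:Z)) N2 q.

Definition fv_bar (n1 n2 : nat) : {poly {poly F}} :=
  p_ n1 (z1 * cst (u1 * s ^- N1)) a N1 q
  * p_ n2 (z2 * cst (s ^+ N2 * u2^-1)) b^-1 N2 q^-1.

Definition fw_bar (n1 n2 : nat) : {poly {poly F}} :=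
  p_ n1 (z1 * cst (s ^+ N1 * u1^-1))
       (b^-1 * q ^ (N2%:Z - 2 * n2%:Z)) N1 q^-1
  * p_ n2 (z2 * cst (s ^+ N2 * u2^-1)) b^-1 N2 q^-1.

(* The operators involve z1^-1 and z2^-1; they act on functions of (z1, z2),
   and are only meaningful at nonzero arguments. *)

Definition shift1 (e : int) (f : F -> F -> F) : F -> F -> F :=
  fun x y => f (q ^ e * x) y.
Definition shift2 (e : int) (f : F -> F -> F) : F -> F -> F :=
  fun x y => f x (q ^ e * y).

Definition alpha : F := a + a^-1.
Definition beta : F := b + b^-1.

Definition opA1 (f : F -> F -> F) : F -> F -> F := fun x y =>
  (u1 * x * s ^+ N1 + u1^-1 * x^-1 * s ^- N1) * f x y
  - u1^-1 * s ^- N1 * x^-1 * (1 - x * u1 * s ^- N1 * a)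
    * (1 - x * u1 * s ^- N1 * a^-1) * shift1 1 (shift1 1 f) x y.

Definition opA2 (f : F -> F -> F) : F -> F -> F := fun x y =>
  (u2 * y * s ^+ N2 + u2^-1 * y^-1 * s ^- N2) * f x y
  - u2^-1 * s ^- N2 * y^-1 * (1 - y * u2 * s ^- N2 * a)
    * (1 - y * u2 * s ^- N2 * a^-1) * shift2 1 (shift2 1 f) x y.

Definition opB1 (f : F -> F -> F) : F -> F -> F := fun x y =>
  (u1^-1 * x * s ^- N1 + u1 * x^-1 * s ^+ N1) * f x y
  - u1 * s ^+ N1 * x^-1 * (1 - x * u1^-1 * s ^+ N1 * b)
    * (1 - x * u1^-1 * s ^+ N1 * b^-1) * shift1 (-1) (shift1 (-1) f) x y.

Definition opB2 (f : F -> F -> F) : F -> F -> F := fun x y =>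
  (u2^-1 * y * s ^- N2 + u2 * y^-1 * s ^+ N2) * f x y
  - u2 * s ^+ N2 * y^-1 * (1 - y * u2^-1 * s ^+ N2 * b)
    * (1 - y * u2^-1 * s ^+ N2 * b^-1) * shift2 (-1) (shift2 (-1) f) x y.

Definition opA12 (f : F -> F -> F) : F -> F -> F := fun x y =>
  opA1 f x y
  + q ^- N1 * shift1 1 (shift1 1 (fun x' y' =>
      opA2 f x' y' - alpha * f x' y')) x y.

Definition opB12 (f : F -> F -> F) : F -> F -> F := fun x y =>
  let g := fun x' y' => q ^+ N2 * shift2 (-1) (shift2 (-1) f) x' y' in
  opB2 f x y + (opB1 g x y - beta * g x y).

Definition opA21 (f : F -> F -> F) : F -> F -> F := fun x y =>
  let g := fun x' y' => q ^- N2 * shift2 1 (shift2 1 f) x' y' in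
  opA2 f x y + (opA1 g x y - alpha * g x y).

Definition opB21 (f : F -> F -> F) : F -> F -> F := fun x y =>
  opB1 f x y
  + q ^+ N1 * shift1 (-1) (shift1 (-1) (fun x' y' =>
      opB2 f x' y' - beta * f x' y')) x y.

Definition theta c (m : int) : F := q ^ m * c + q ^ (- m) * c^-1.

Definition ev_u (n1 n2 : nat) : F * F :=
  (theta a (2 * n2%:Z - N2%:Z),
   theta a (2 * n1%:Z + 2 * n2%:Z - N1%:Z - N2%:Z)).
Definition ev_v (n1 n2 : nat) : F * F :=
  (theta a (2 * n2%:Z - N2%:Z), theta b (2 * n1%:Z - N1%:Z)).
Definition ev_w (n1 n2 : nat) : F * F :=
  (theta b (2 * n1%:Z - N1%:Z),
   theta b (2 * n1%:Z + 2 * n2%:Z - N1%:Z - N2%:Z)).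
Definition ev_u_bar (n1 n2 : nat) : F * F :=
  (theta a (2 * n1%:Z - N1%:Z),
   theta a (2 * n1%:Z + 2 * n2%:Z - N1%:Z - N2%:Z)).
Definition ev_v_bar (n1 n2 : nat) : F * F :=
  (theta a (2 * n1%:Z - N1%:Z), theta b (2 * n2%:Z - N2%:Z)).
Definition ev_w_bar (n1 n2 : nat) : F * F :=
  (theta b (2 * n2%:Z - N2%:Z),
   theta b (2 * n1%:Z + 2 * n2%:Z - N1%:Z - N2%:Z)).

Definition coefT (k1 k2 l1 l2 : nat) : F :=
  R_ k1 l1 (a * q ^ (2 * l2%:Z - N2%:Z)) b u1 N1 q
  * R_ k2 l2 a (b * q ^ (2 * k1%:Z - N1%:Z)) u2 N2 q.

Definition coefS (k1 k2 l1 l2 : nat) : F :=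
  R_ k1 l1 (a * q ^ (2 * l2%:Z - N2%:Z)) (b * q ^ (2 * k2%:Z - N2%:Z)) u1 N1 q
  * R_ k2 l2 a b u2 N2 q.

Definition coefT_bar (k1 k2 l1 l2 : nat) : F :=
  R_ k1 l1 a (b * q ^ (2 * k2%:Z - N2%:Z)) u1 N1 q
  * R_ k2 l2 (a * q ^ (2 * l1%:Z - N1%:Z)) b u2 N2 q.

Definition coefS_bar (k1 k2 l1 l2 : nat) : F :=
  R_ k1 l1 a b u1 N1 q
  * R_ k2 l2 (a * q ^ (2 * l1%:Z - N1%:Z)) (b * q ^ (2 * k1%:Z - N1%:Z)) u2 N2 q.

Definition coefs_well_defined (k1 k2 l1 l2 : nat) : Prop :=
  [/\ R_well_defined k1 l1 (a * q ^ (2 * l2%:Z - N2%:Z)) b u1 N1 q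
      /\ R_well_defined k2 l2 a (b * q ^ (2 * k1%:Z - N1%:Z)) u2 N2 q,
      R_well_defined k1 l1 (a * q ^ (2 * l2%:Z - N2%:Z))
                           (b * q ^ (2 * k2%:Z - N2%:Z)) u1 N1 q
      /\ R_well_defined k2 l2 a b u2 N2 q,
      R_well_defined k1 l1 a (b * q ^ (2 * k2%:Z - N2%:Z)) u1 N1 q
      /\ R_well_defined k2 l2 (a * q ^ (2 * l1%:Z - N1%:Z)) b u2 N2 q
    & R_well_defined k1 l1 a b u1 N1 q
      /\ R_well_defined k2 l2 (a * q ^ (2 * l1%:Z - N1%:Z))
                              (b * q ^ (2 * k1%:Z - N1%:Z)) u2 N2 q].

End Families.

Definition pairwise_distinct N1 N2 (ev : nat -> nat -> F * F) : Prop :=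
  injective (fun n : 'I_N1.+1 * 'I_N2.+1 => ev n.1 n.2).

Definition is_basis N1 N2 (f : nat -> nat -> {poly {poly F}}) : Prop :=
  (forall (n1 : 'I_N1.+1) (n2 : 'I_N2.+1), tensor_space N1 N2 (f n1 n2))
  /\ forall p, tensor_space N1 N2 p ->
       exists! c : 'M[F]_(N1.+1, N2.+1),
         p = \sum_(l1 < N1.+1) \sum_(l2 < N2.+1) cst (c l1 l2) * f l1 l2.

(* A polynomial is determined by its values at nonzero arguments when F is
   infinite, so the pointwise equations are identities of Laurent polynomials. *)
Definition joint_eigenvector (A B : (F -> F -> F) -> F -> F -> F)
    (ev : F * F) (p : {poly {poly F}}) : Prop :=
  forall x y, x != 0 -> y != 0 ->
    A (bieval p) x y = ev.1 * bieval p x y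
    /\ B (bieval p) x y = ev.2 * bieval p x y.

Definition joint_eigenbasis N1 N2 (A B : (F -> F -> F) -> F -> F -> F)
    (ev : nat -> nat -> F * F) (f : nat -> nat -> {poly {poly F}}) : Prop :=
  is_basis N1 N2 f
  /\ forall (n1 : 'I_N1.+1) (n2 : 'I_N2.+1),
       joint_eigenvector A B (ev n1 n2) (f n1 n2).

End Overlap.

(* Main.v *)
(* Everything reduces to one variable. With Q = q^2, W = z u q^-j and
   c = q^(2-2j) u^-2, the polynomial p_n(z q^j/u; 1/b, j, 1/q) equals
   (W c b Q^n; Q)_(N-n) (W (c/b) Q^(N-n); Q)_n. Its second factor is expanded in
   the products (W a)_i (W c b Q^i)_(n-i), and then each (W c b Q^i)_(N-i) in the
   products (W a Q^i)_m (W/a)_(N-i-m). Both expansions are proved by induction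
   from q-Pascal recursions; composing them, the coefficient of
   (W a)_l (W/a)_(N-l) is a single sum over i which is R_ term by term, once the
   Pochhammer symbols at negative powers of Q are reversed.

   For the eigenvalue statements, replacing a by a' = a q^m in A_1 changes it by
   a multiple of T_+^2, and this cancels the coupling term of A_12 on u. The B
   operators and the families w are the A operators and the families u-bar, u at
   the inverted parameters q^-1, s^-1, b^-1, u_i^-1. *)

Require Import Defs.
From mathcomp Require Import all_boot all_order all_algebra.
From mathcomp Require Import all_real_closed reals.
From mathcomp Require Import ring.
Import GRing.Theory.
Local Open Scope ring_scope.

(** * q-Pochhammer symbols: splitting, reversal and change of base *)

Section QPochhammer.

Lemma qpoch0 {A : comNzRingType} (z Q : A) : qpoch z Q 0 = 1.
Proof. by rewrite /qpoch big_ord0. Qed.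

Lemma qpochSr {A : comNzRingType} (z Q : A) n :
  qpoch z Q n.+1 = qpoch z Q n * (1 - z * Q ^+ n).
Proof. by rewrite /qpoch big_ord_recr. Qed.

Lemma qpochS {A : comNzRingType} (z Q : A) n :
  qpoch z Q n.+1 = (1 - z) * qpoch (z * Q) Q n.
Proof.
rewrite /qpoch big_ord_recl expr0 mulr1; congr (_ * _).
by apply: eq_bigr => i _; rewrite /bump /= exprS mulrA.
Qed.

Lemma qpochD {A : comNzRingType} (z Q : A) m n :
  qpoch z Q (m + n) = qpoch z Q m * qpoch (z * Q ^+ m) Q n.
Proof.
elim: n => [|n IHn]; first by rewrite addn0 qpoch0 mulr1.
by rewrite addnS !qpochSr IHn exprD !mulrA.
Qed.

Lemma rmorph_qpoch {A B : comNzRingType} (f : {rmorphism A -> B}) z Q n :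
  f (qpoch z Q n) = qpoch (f z) (f Q) n.
Proof.
rewrite /qpoch rmorph_prod; apply: eq_bigr => i _.
by rewrite rmorphB rmorph1 rmorphM rmorphXn.
Qed.

Lemma qpoch_eq0 {F : fieldType} (z Q : F) n :
  (qpoch z Q n == 0) = [exists i : 'I_n, z * Q ^+ i == 1].
Proof.
apply/idP/existsP => [/eqP/eqP|[i /eqP zi]].
  by rewrite /qpoch prodf_seq_eq0 => /hasP[i _ /=]; rewrite subr_eq0 eq_sym; exists i.
by rewrite /qpoch (bigD1 i) //= zi subrr mul0r.
Qed.

(** With [x = Q / (Q^n t)], the factor [1 - x Q^i] is [- x Q^i] times the factor [1 - t Q^(n-1-i)]
    of the symbol at [t]. The product of the [- Q^r] is left unevaluated because it cancels later
    between numerators and denominators. *)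
Lemma qpoch_rev {F : fieldType} (t Q : F) n : Q != 0 -> t != 0 ->
  qpoch (Q / (Q ^+ n * t)) Q n
  = (\prod_(r < n) - Q ^+ r) * (Q / (Q ^+ n * t)) ^+ n * qpoch t Q n.
Proof.
move=> Q0 t0; rewrite [qpoch t Q n](reindex_inj rev_ord_inj) /qpoch /=.
have powE x : \prod_(i < n) x = x ^+ n :> F by rewrite prodr_const card_ord.
rewrite -(powE (Q / _)) -!big_split /=.
apply: eq_bigr => i _.
have -> : Q ^+ n = Q ^+ i * Q ^+ (n - i.+1) * Q.
  by rewrite -exprD -exprSr; congr (_ ^+ _); rewrite addnC -addnS subnK.
have := expf_neq0 (n - i.+1) Q0; have := expf_neq0 i Q0.
move: (Q ^+ _) (Q ^+ _) => A B A0 B0; field.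
by rewrite A0 B0 t0 Q0.
Qed.

(** Reading the factors backwards turns base [Q^-1] into base [Q] and moves the parameter to
    [x Q^(1-n)]. [W] lies in a ring without division, so scalars enter through [f]. *)
Lemma qpoch_inv_base {F : fieldType} {A : comNzRingType} (f : {rmorphism F -> A})
    (W : A) (x Q : F) n : Q != 0 ->
  qpoch (W * f x) (f Q^-1) n = qpoch (W * f (x * (Q / Q ^+ n))) (f Q) n.
Proof.
move=> Q0; rewrite /qpoch (reindex_inj rev_ord_inj) /=.
apply: eq_bigr => i _; congr (1 - _).
rewrite -!mulrA; congr (_ * _); rewrite -!rmorphXn -!rmorphM; congr (f _).
have -> : Q ^+ n = Q ^+ i * Q ^+ (n - i.+1) * Q.
  by rewrite -exprD -exprSr; congr (_ ^+ _); rewrite addnC -addnS subnK.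
rewrite exprVn.
have := expf_neq0 (n - i.+1) Q0; have := expf_neq0 i Q0.
move: (Q ^+ _) (Q ^+ _) => B C B0 C0; field.
by rewrite C0 B0 Q0.
Qed.

(** Collects the two contributions to each [G i]. The three hypotheses are the two ends and the
    interior of a Pascal rule; both expansions below make their induction step with it. *)
Lemma sum_pascal {A : pzRingType} (G a b c : nat -> A) n :
  c 0%N = b 0%N -> c n.+1 = a n ->
  (forall i, (i < n)%N -> c i.+1 = a i + b i.+1) ->
  \sum_(i < n.+1) (a i * G i.+1 + b i * G i) = \sum_(i < n.+2) c i * G i.
Proof.
move=> c0 cn cS; rewrite big_split /= [X in X + _]big_ord_recr /=.
rewrite [X in _ + X]big_ord_recl [RHS]big_ord_recl [X in _ = _ + X]big_ord_recr /=.
have -> : \sum_(i < n) c (bump 0 i) * G (bump 0 i) =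
          \sum_(i < n) a i * G i.+1 + \sum_(i < n) b (bump 0 i) * G (bump 0 i).
  by rewrite -big_split; apply: eq_bigr => i _; rewrite /bump /= cS // mulrDl.
by rewrite c0 cn addrCA addrAC.
Qed.

End QPochhammer.

(** * Two expansions of Pochhammer symbols from q-Pascal recursions *)

Section Expansions.
Variables (F : fieldType) (A : comNzRingType) (f : {rmorphism F -> A}) (Q : F).
Hypothesis Q0 : Q != 0.
Hypothesis Q_not_root1 : forall n, (0 < n)%N -> Q ^+ n != 1.

Lemma qpochQ_neq0 n : qpoch Q Q n != 0.
Proof.
rewrite qpoch_eq0 negb_exists; apply/forallP => i.
by rewrite -exprS Q_not_root1.
Qed.

(** A q-binomial expansion with a free parameter [t]. The prefactor [(t v; Q)_k] on the left keeps
    [t] and [v] out of the denominators, so the identity holds for all values and the induction can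
    move from [v] to [v Q]. *)
Lemma qpoch_binomial k (v t : F) (W : A) :
  f (qpoch (t * v) Q k) * qpoch (W * f v) (f Q) k =
  \sum_(i < k.+1)
    f (qbinom k i Q * qpoch v Q (k - i) * qpoch t Q i * v ^+ i)
    * (qpoch W (f Q) i * qpoch (W * f (t * v * Q ^+ i)) (f Q) (k - i)).
Proof.
elim: k v => [|k IHk] v.
  by rewrite big_ord1 /qbinom /qbinom_den /= subnn !qpoch0 !mulr1 divr1.
pose G i := qpoch W (f Q) i * qpoch (W * f (t * v * Q ^+ i)) (f Q) (k.+1 - i).
pose e i := qbinom k i Q * qpoch (v * Q) Q (k - i) * qpoch t Q i * v ^+ i.
pose c i := qbinom k.+1 i Q * qpoch v Q (k.+1 - i) * qpoch t Q i * v ^+ i.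
rewrite -(sum_pascal G (fun i => f (e i * v * (1 - t * Q ^+ i)))
            (fun i => f (e i * (Q ^+ i - v))) (fun i => f (c i))); first last.
- move=> i /subnKC; move: (k - i.+1)%N => m km; rewrite -rmorphD; congr (f _).
  rewrite /c /e /qbinom /qbinom_den -km.
  have -> : ((i.+1 + m).+1 - i.+1 = m.+1)%N by rewrite -addnS addKn.
  have -> : (i.+1 + m - i = m.+1)%N by rewrite addSnnS addKn.
  rewrite addKn [qpoch Q Q (i.+1 + m).+1]qpochSr (qpochS v).
  have := qpochQ_neq0 i.+1; have := qpochQ_neq0 m.+1.
  rewrite !qpochSr exprD !exprS !mulf_eq0 !negb_or => /andP[h1 h2] /andP[h3 h4].
  have := qpochQ_neq0 (i.+1 + m).
  move: h1 h2 h3 h4.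
  move: (Q ^+ i) (Q ^+ m) (qpoch Q Q i) (qpoch Q Q m) (qpoch Q Q _) => X Y B C D.
  move: (qpoch _ _ _) (qpoch _ _ _) (v ^+ i) => E H I h1 h2 h3 h4 h5.
  by field; rewrite h1 h2 h3 h4.
- congr (f _); rewrite /c /e /qbinom /qbinom_den !subnn !qpoch0 !mulr1 !divff ?qpochQ_neq0 //.
  by rewrite !mul1r qpochSr exprSr mulrAC mulrA.
- congr (f _); rewrite /c /e /qbinom /qbinom_den !subn0 !qpoch0 !mul1r !divff ?qpochQ_neq0 //.
  by rewrite qpochS !expr0 !mulr1 !mul1r mulrC.
(* With the first factors split off and the induction hypothesis used at [v Q], each term reduces to
   [Q^i (1 - t v) (1 - W v) = v (1 - t Q^i) (1 - W Q^i) + (Q^i - v) (1 - t v W Q^i)]. *)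
rewrite qpochS (qpochS (W * f v)) rmorphM mulrACA.
have -> : t * v * Q = t * (v * Q) by rewrite mulrA.
have -> : W * f v * f Q = W * f (v * Q) by rewrite rmorphM mulrA.
rewrite IHk mulr_sumr; apply: eq_bigr => i _.
have ik : (i <= k)%N by rewrite -ltnS.
rewrite /G subSS subSn // qpochSr (qpochS (W * f (t * v * Q ^+ i))).
have -> : W * f (t * v * Q ^+ i) * f Q = W * f (t * (v * Q) * Q ^+ i).
  by rewrite -mulrA -rmorphM; congr (_ * f _); rewrite -!mulrA; congr (_ * (_ * _)); rewrite mulrC.
have -> : W * f (t * v * Q ^+ i.+1) = W * f (t * (v * Q) * Q ^+ i).
  by rewrite exprS !mulrA.
have -> : qbinom k i Q * qpoch (v * Q) Q (k - i) * qpoch t Q i * (v * Q) ^+ i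
   = e i * Q ^+ i by rewrite exprMn !mulrA.
move: (e i) (qpoch _ _ _) (qpoch _ _ _) => a0 a1 a2.
rewrite !(rmorphM, rmorphB, rmorph1) rmorphXn; ring.
Qed.


(** The coefficient of [(W y; Q)_i (W z; Q)_k] in [(W x; Q)_(i+k)]. Indexing by the two lengths
    makes it symmetric under the exchange of [(y, i)] and [(z, k)]. *)
Definition connection_coef (x y z : F) (i k : nat) : F :=
  qpoch Q Q (i + k) / (qpoch Q Q i * qpoch Q Q k)
  * (qpoch (x / z) Q i * qpoch (x / y) Q k / Q ^+ (i * k))
  / (qpoch (y / z / Q ^+ k) Q i * qpoch (z / y / Q ^+ i) Q k).

Lemma connection_den_neq0 (y z : F) i k : z != 0 ->
  (forall r, (r < i)%N -> y * Q ^+ r != z * Q ^+ k) ->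
  qpoch (y / z / Q ^+ k) Q i != 0.
Proof.
move=> z0 yz; rewrite qpoch_eq0 negb_exists; apply/forallP => r.
apply: contra (yz r (ltn_ord r)) => /eqP yz1; apply/eqP.
have := congr1 ( *%R^~ (z * Q ^+ k)) yz1; rewrite mul1r => <-.
by field; rewrite z0 expf_neq0.
Qed.

(** What remains of [connection_pascal] for [X = Q^i], [K = Q^k], [r = z / y] once the common
    Pochhammer symbols, among them everything that contains [x], have cancelled. *)
Lemma connection_pascal_aux (X K r : F) : X != 0 -> K != 0 -> X != r * K -> r != 0 ->
  1 - Q * (Q * (X * K)) =
  Q * ((1 - Q * X) * K * (1 - r / (Q * X)) / (1 - r / (Q * X) * (Q * K))
       + (1 - Q * K) * X * (1 - r^-1 / (Q * K)) / (1 - r^-1 / (Q * K) * (Q * X))).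
Proof.
move=> X0 K0 XrK r0.
have h1 : X - r * K != 0 by rewrite subr_eq0.
have h2 : r * K - X != 0 by rewrite subr_eq0 eq_sym.
by field; rewrite h1 h2 X0 K0 r0 Q0.
Qed.

(** Both sides, multiplied by [1 - t / Q^(n+1)], are the symbol of length [m + 2] at [t / Q^(n+1)].
    This brings the denominators of neighbouring connection coefficients over one common symbol. *)
Lemma qpoch_shift (t : F) n m : 1 - t / Q ^+ n.+1 != 0 ->
  qpoch (t / Q ^+ n) Q m.+1 = qpoch (t / Q ^+ n.+1) Q m
    * (1 - t / Q ^+ n.+1 * Q ^+ m) * (1 - t / Q ^+ n.+1 * Q ^+ m.+1)
    / (1 - t / Q ^+ n.+1).
Proof.
move=> nz; apply: (mulIf nz); rewrite divfK // -!qpochSr [RHS]qpochS mulrC exprS.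
by congr (_ * qpoch _ _ _); field; rewrite Q0 expf_neq0.
Qed.

(** The lengths [(i+1, k+1)] are reached from [(i, k+1)] by a factor in [y] and from [(i+1, k)] by a
    factor in [z]; the weights are those that split [1 - W x Q^(i+k+1)] into these two factors. *)
Lemma connection_pascal (x y z : F) i k : y != 0 -> z != 0 ->
  (forall i' k', (i' + k' <= (i + k).+1)%N -> y * Q ^+ i' != z * Q ^+ k') ->
  connection_coef x y z i.+1 k.+1 =
  (x * Q ^+ (i + k.+1) - z * Q ^+ k.+1) / (y * Q ^+ i - z * Q ^+ k.+1)
    * connection_coef x y z i k.+1
  + (y * Q ^+ i.+1 - x * Q ^+ (i.+1 + k)) / (y * Q ^+ i.+1 - z * Q ^+ k)
    * connection_coef x y z i.+1 k.
Proof.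
move=> y0 z0 gen.
have yz i' k' : (i' + k' <= (i + k).+1)%N -> y * Q ^+ i' - z * Q ^+ k' != 0.
  by move=> /gen; rewrite subr_eq0.
have h1 := yz i k.+1; have h2 := yz i.+1 k.
have h3 := gen 0%N k.+1; have h4 := gen i.+1 0%N; have h7 := gen i k.
rewrite ?addnS ?addSn ?add0n ?addn0 ?ltnS ?leq_addl ?leq_addr ?leqnn ?leqnSn in h1 h2 h3 h4 h7.
have {}h1 := h1 isT; have {}h2 := h2 isT; have {}h3 := h3 isT.
have {}h4 := h4 isT; have {}h7 := h7 isT.
have h5 : qpoch (y / z / Q ^+ k.+1) Q i.+1 != 0.
  apply: connection_den_neq0 => // r ri.
  by apply: gen; rewrite addnS ltnS leq_add2r -ltnS.
have h6 : qpoch (z / y / Q ^+ i.+1) Q k.+1 != 0.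
  apply: connection_den_neq0 => // r rk; rewrite eq_sym.
  by apply: gen; rewrite addSn ltnS leq_add2l -ltnS.
have h8 : 1 - y / z / Q ^+ k.+1 != 0.
  rewrite -[1 - _]mul1r -[X in X * (1 - _)](qpoch0 (y / z / Q ^+ k.+1) Q).
  have := @connection_den_neq0 y z 1 k.+1 z0; rewrite qpochSr expr0 mulr1; apply.
  by case=> // _; rewrite h3.
have h9 : 1 - z / y / Q ^+ i.+1 != 0.
  rewrite -[1 - _]mul1r -[X in X * (1 - _)](qpoch0 (z / y / Q ^+ i.+1) Q).
  have := @connection_den_neq0 z y 1 i.+1 y0; rewrite qpochSr expr0 mulr1; apply.
  by case=> // _; rewrite eq_sym h4.
rewrite /connection_coef (qpoch_shift (y / z) k i) // (qpoch_shift (z / y) i k) //.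
move: h5 h6; rewrite [qpoch (y / z / Q ^+ k.+1) Q i.+1]qpochSr.
rewrite [qpoch (z / y / Q ^+ i.+1) Q k.+1]qpochSr !mulf_eq0 !negb_or.
move=> /andP[p6 s0] /andP[p5 t0].
have := qpochQ_neq0 i.+1; have := qpochQ_neq0 k.+1.
rewrite !addnS addSn [qpoch _ _ (i + k).+2]qpochSr; set B := qpoch Q Q (i + k).+1.
rewrite !qpochSr !mulf_eq0 !negb_or => /andP[q3 q12] /andP[q4 q11].
have X0 := expf_neq0 i Q0; have K0 := expf_neq0 k Q0.
have Z0 := expf_neq0 (i * k) Q0.
(* In this form the numerators of the two weights are the last factors of [(x/z; Q)_(i+1)] and
   [(x/y; Q)_(k+1)], and their denominators are the last factors of the two lower symbols at
   [(i+1, k+1)]. *)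
have -> : (x * Q ^+ (i + k).+1 - z * Q ^+ k.+1) / (y * Q ^+ i - z * Q ^+ k.+1)
    = (1 - x / z * Q ^+ i) / (1 - y / z / Q ^+ k.+1 * Q ^+ i).
  move: h1; rewrite !exprS exprD => h1; field.
  by rewrite h1 K0 Q0 z0 -opprB oppr_eq0 h1.
have -> : (y * Q ^+ i.+1 - x * Q ^+ (i + k).+1) / (y * Q ^+ i.+1 - z * Q ^+ k)
    = (1 - x / y * Q ^+ k) / (1 - z / y / Q ^+ i.+1 * Q ^+ k).
  move: h2; rewrite !exprS exprD => h2; field.
  by rewrite h2 X0 Q0 y0.
(* One power of [Q] cancels here and in [t1], so both conditions are [y Q^i != z Q^k]. *)
have s1 : 1 - y / z / Q ^+ k.+1 * Q ^+ i.+1 != 0.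
  apply: contra h7; rewrite subr_eq0 => /eqP e; apply/eqP.
  have := congr1 ( *%R^~ (z * Q ^+ k)) e; rewrite mul1r => ->.
  by rewrite !exprS; field; rewrite K0 Q0 z0.
have t1 : 1 - z / y / Q ^+ i.+1 * Q ^+ k.+1 != 0.
  apply: contra h7; rewrite subr_eq0 => /eqP e; apply/eqP.
  have := congr1 ( *%R^~ (y * Q ^+ i)) e; rewrite mul1r => ->.
  by rewrite !exprS; field; rewrite X0 Q0 y0.
have key : 1 - Q * Q ^+ (i + k).+1 =
  Q * ((1 - Q * Q ^+ i) * Q ^+ k * (1 - z / y / Q ^+ i.+1)
        / (1 - z / y / Q ^+ i.+1 * Q ^+ k.+1)
       + (1 - Q * Q ^+ k) * Q ^+ i * (1 - y / z / Q ^+ k.+1)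
        / (1 - y / z / Q ^+ k.+1 * Q ^+ i.+1)).
  rewrite !exprS exprD (@connection_pascal_aux (Q ^+ i) (Q ^+ k) (z / y)) ?invf_div //.
    apply: contra h7 => /eqP ->; apply/eqP; by field.
  by rewrite mulf_neq0 ?invr_eq0.
have -> : Q ^+ (i.+1 * k.+1) = Q * Q ^+ k * Q ^+ i * Q ^+ (i * k).
  by rewrite mulSn mulnS !exprD exprS !mulrA.
have -> : Q ^+ (i * k.+1) = Q ^+ i * Q ^+ (i * k) by rewrite mulnS exprD.
have -> : Q ^+ (i.+1 * k) = Q ^+ k * Q ^+ (i * k) by rewrite mulSn exprD.
rewrite key.
move: (Q ^+ (i * k)) Z0 (Q ^+ i) X0 (Q ^+ k) K0 s0 t0 h8 h9 s1 t1 q12 q11 => Z Z0 X X0 K K0.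
move: (1 - y / z / Q ^+ k.+1 * X) => s0.
move: (1 - z / y / Q ^+ i.+1 * K) => t0.
move: (1 - y / z / Q ^+ k.+1 * _) (1 - z / y / Q ^+ i.+1 * _) => s1 t1.
move: (1 - y / z / _) (1 - z / y / _) (1 - Q * X) (1 - Q * K) => s2 t2 m1 m2.
move: (1 - _) (1 - _) => x1 x2 s0n t0n s2n t2n s1n t1n m2n m1n.
field.
by rewrite Q0 X0 K0 Z0 s0n t0n s1n t1n s2n t2n m1n m2n p5 p6 q3 q4.
Qed.

(** Induction on [N]: the new factor [1 - W x Q^N] is written, in the term of lengths [(i, N-i)], as
    a combination of the next factors [1 - W y Q^i] and [1 - W z Q^(N-i)]. This is possible because
    [y Q^i] and [z Q^(N-i)] differ. *)
Lemma qpoch_connection N (x y z : F) (W : A) : y != 0 -> z != 0 ->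
  (forall i k, (i + k < N)%N -> y * Q ^+ i != z * Q ^+ k) ->
  qpoch (W * f x) (f Q) N =
  \sum_(m < N.+1) f (connection_coef x y z m (N - m))
    * (qpoch (W * f y) (f Q) m * qpoch (W * f z) (f Q) (N - m)).
Proof.
move=> y0 z0; elim: N => [|N IHN] gen.
  rewrite big_ord1 /connection_coef /= subnn !qpoch0 muln0 expr0 !(mulr1, divr1).
  by rewrite rmorph1.
have yz i k : (i + k < N.+1)%N -> y * Q ^+ i - z * Q ^+ k != 0.
  by move=> /gen; rewrite subr_eq0.
pose al i k := (x * Q ^+ (i + k) - z * Q ^+ k) / (y * Q ^+ i - z * Q ^+ k).
pose be i k := (y * Q ^+ i - x * Q ^+ (i + k)) / (y * Q ^+ i - z * Q ^+ k).
pose cc := connection_coef x y z.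
pose G m := qpoch (W * f y) (f Q) m * qpoch (W * f z) (f Q) (N.+1 - m).
rewrite -(sum_pascal G (fun m => f (al m (N - m)%N * cc m (N - m)%N))
            (fun m => f (be m (N - m)%N * cc m (N - m)%N))
            (fun m => f (cc m (N.+1 - m)%N))); first last.
- move=> i iN; rewrite -rmorphD; congr (f _).
  have {iN} [k kN] : exists k, N = (i + k.+1)%N.
    by exists (N - i.+1)%N; rewrite addnS -addSn subnKC.
  have -> : (N - i = k.+1)%N by rewrite kN addKn.
  have -> : (N - i.+1 = k)%N by rewrite kN -addSnnS addKn.
  have -> : (N.+1 - i.+1 = k.+1)%N by rewrite kN subSS addKn.
  apply: connection_pascal => // i' k' ik.
  by apply: gen; rewrite kN addnS ltnS.
(* At each end one of the two lengths is 0 and only one of the two weights contributes. *)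
- have h := yz N 0%N; rewrite addn0 expr0 mulr1 in h; have {}h := h (leqnn _).
  have := @connection_den_neq0 y z N.+1 0 z0.
  rewrite /cc /al /connection_coef !subnn !muln0 !addn0 !qpoch0 expr0 !mulr1 !divr1.
  rewrite !divff ?qpochQ_neq0 // !mul1r !qpochSr mulf_eq0 negb_or => /(_ _)/andP[].
    by move=> r rN; have := gen r 0%N; rewrite expr0 mulr1 addn0; apply.
  move=> h1 h2; congr (f _).
  have -> : (x * Q ^+ N - z) / (y * Q ^+ N - z)
      = (1 - x / z * Q ^+ N) / (1 - y / z * Q ^+ N).
    by field; rewrite -[z - _]opprB oppr_eq0 h z0.
  move: (1 - y / z * _) (qpoch (y / z) Q N) h1 h2 => d p h1 h2.
  by field; rewrite h1 h2.
- have h := yz 0%N N; rewrite expr0 mulr1 in h; have {}h := h (leqnn _).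
  have := @connection_den_neq0 z y N.+1 0 y0.
  rewrite /cc /be /connection_coef !subn0 !mul0n !add0n !qpoch0 expr0 !mulr1 !divr1.
  rewrite !mul1r !divff ?qpochQ_neq0 // !mul1r !qpochSr mulf_eq0 negb_or => /(_ _)/andP[].
    by move=> r rN; have := gen 0%N r; rewrite eq_sym expr0 mulr1; apply.
  move=> h1 h2; congr (f _).
  have -> : (y - x * Q ^+ N) / (y - z * Q ^+ N)
      = (1 - x / y * Q ^+ N) / (1 - z / y * Q ^+ N).
    by field; rewrite h y0.
  move: (1 - z / y * _) (qpoch (z / y) Q N) h1 h2 => d p h1 h2.
  by field; rewrite h1 h2.
rewrite qpochSr IHN => [|i k ik]; last by apply: gen; apply: ltnW.
rewrite mulr_suml; apply: eq_bigr => i _.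
have iN : (i <= N)%N by rewrite -ltnS.
have h : y * Q ^+ i - z * Q ^+ (N - i) != 0 by apply: yz; rewrite subnKC.
rewrite /G subSS subSn // !qpochSr.
(* Both sides are affine in [W]: [e1] compares the constant terms and [e2] the coefficients of
   [W]. *)
have -> : 1 - W * f x * f Q ^+ N =
  f (al i (N - i)%N) * (1 - W * f y * f Q ^+ i)
  + f (be i (N - i)%N) * (1 - W * f z * f Q ^+ (N - i)).
  have e1 : al i (N - i)%N + be i (N - i)%N = 1.
    by rewrite /al /be -mulrDl addrC addrA subrK divff.
  have e2 : al i (N - i)%N * (y * Q ^+ i) + be i (N - i)%N * (z * Q ^+ (N - i))
      = x * Q ^+ N.
    by rewrite /al /be subnKC //; field.
  move: (al _ _) (be _ _) e1 e2 => p r e1 e2.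
  rewrite -!rmorphXn -!mulrA -!rmorphM -e2 rmorphD !rmorphM.
  have -> : f p = 1 - f r by rewrite -(rmorph1 f) -e1 rmorphD addrK.
  ring.
move: (al _ _) (be _ _) => p r; rewrite !rmorphM; ring.
Qed.
End Expansions.
Arguments connection_coef {F}.

(** * The one-variable connection formula and its general term *)

Section OneVariable.
Variables (F : fieldType) (A : comNzRingType) (f : {rmorphism F -> A}) (Q : F).
Hypothesis Q0 : Q != 0.
Hypothesis Q_not_root1 : forall n, (0 < n)%N -> Q ^+ n != 1.

(** The condition [a Q^i != a^-1 Q^k] of [qpoch_connection], multiplied by [a]: it makes the
    products [(W a; Q)_l (W / a; Q)_(N-l)] independent. *)
Definition generic (a : F) (N : nat) : Prop :=
  forall i k, (i + k < N)%N -> a ^+ 2 * Q ^+ i != Q ^+ k.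

(** The coefficient of [qpoch_binomial] for [t = b^2 Q^n / Q^N] and [W] replaced by [W a], divided
    by its prefactor: here [t v = c b / a]. *)
Definition binomial_coef (a b c : F) (n N i : nat) : F :=
  let v := c / (a * b) * Q ^+ (N - n) in
  qbinom n i Q * qpoch v Q (n - i) * qpoch (b ^+ 2 * Q ^+ n / Q ^+ N) Q i * v ^+ i
  / qpoch (c * b / a) Q n.

Lemma sum_ord_shift (G : nat -> A) i N : (i <= N)%N ->
  \sum_(m < (N - i).+1) G (i + m)%N = \sum_(l < N.+1 | (i <= l)%N) G l.
Proof.
move=> iN; rewrite -(big_geq_mkord i N.+1 xpredT) -[i in RHS]add0n big_addn subSn //.
by rewrite big_mkord; apply: eq_bigr => m _; rewrite addnC.
Qed.

(** The two expansions compose by gluing symbols: [(W c b Q^i; Q)_(n-i)] from the first one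
    continues into the factor [(W c b Q^n; Q)_(N-n)], and after the second one
    [(W a; Q)_i (W a Q^i; Q)_m] is [(W a; Q)_(i+m)]. Hence [l = i + m] and the constraint
    [i <= l]. *)
Lemma connection_formula (a b c : F) (W : A) (n N : nat) :
  a != 0 -> b != 0 -> (n <= N)%N -> generic a N -> qpoch (c * b / a) Q n != 0 ->
  qpoch (W * f (c * b * Q ^+ n)) (f Q) (N - n)
  * qpoch (W * f (c / b * Q ^+ (N - n))) (f Q) n =
  \sum_(l < N.+1)
    f (\sum_(i < n.+1 | (i <= l)%N) binomial_coef a b c n N i
         * connection_coef Q (c * b * Q ^+ i) (a * Q ^+ i) a^-1 (l - i) (N - l))
    * (qpoch (W * f a) (f Q) l * qpoch (W * f a^-1) (f Q) (N - l)).
Proof.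
move=> a0 b0 nN gen den.
pose v := c / (a * b) * Q ^+ (N - n).
pose t := b ^+ 2 * Q ^+ n / Q ^+ N.
have tvE : t * v = c * b / a.
  rewrite /t /v -[N in _ / Q ^+ N](subnKC nN) exprD; field.
  by rewrite a0 b0 !expf_neq0.
have E : qpoch (W * f (c / b * Q ^+ (N - n))) (f Q) n =
    \sum_(i < n.+1) f (binomial_coef a b c n N i)
      * (qpoch (W * f a) (f Q) i * qpoch (W * f (c * b * Q ^+ i)) (f Q) (n - i)).
  have -> : W * f (c / b * Q ^+ (N - n)) = W * f a * f v.
    by rewrite -[RHS]mulrA -rmorphM; congr (_ * f _); rewrite /v; field; rewrite a0 b0.
  have := qpoch_binomial F A f Q Q_not_root1 n v t (W * f a).
  rewrite tvE => /(congr1 ( *%R (f (qpoch (c * b / a) Q n)^-1))).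
  rewrite mulrA -rmorphM mulVf // rmorph1 mul1r => ->.
  rewrite mulr_sumr; apply: eq_bigr => i _.
  rewrite mulrA -rmorphM; congr (f _ * (_ * qpoch _ _ _)).
    by rewrite /binomial_coef mulrC.
  by rewrite -[in LHS]mulrA -rmorphM; congr (_ * f _); field.
rewrite E mulr_sumr.
under [RHS]eq_bigr do rewrite rmorph_sum mulr_suml big_mkcond /=.
rewrite exchange_big /=; apply: eq_bigr => i _.
rewrite -big_mkcond /=.
have ik : (i <= n)%N by rewrite -ltnS.
have iN := leq_trans ik nN.
pose G l := f (binomial_coef a b c n N i
      * connection_coef Q (c * b * Q ^+ i) (a * Q ^+ i) a^-1 (l - i) (N - l))
    * (qpoch (W * f a) (f Q) l * qpoch (W * f a^-1) (f Q) (N - l)).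
rewrite -(sum_ord_shift G) //.
have -> : qpoch (W * f (c * b * Q ^+ n)) (f Q) (N - n) *
    (f (binomial_coef a b c n N i) *
     (qpoch (W * f a) (f Q) i * qpoch (W * f (c * b * Q ^+ i)) (f Q) (n - i)))
  = f (binomial_coef a b c n N i) * qpoch (W * f a) (f Q) i
    * qpoch (W * f (c * b * Q ^+ i)) (f Q) (N - i).
  have -> : (N - i = (n - i) + (N - n))%N by rewrite addnC addnBA // subnK.
  rewrite qpochD.
  have -> : W * f (c * b * Q ^+ i) * f Q ^+ (n - i) = W * f (c * b * Q ^+ n).
    by rewrite -rmorphXn -mulrA -rmorphM -mulrA -exprD subnKC.
  ring.
rewrite (qpoch_connection F A f Q Q0 Q_not_root1 (N - i) _ (a * Q ^+ i) a^-1);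
  rewrite ?invr_eq0 ?mulf_neq0 ?expf_neq0 //; last first.
  (* The second expansion has length [N - i], so [i + r + s < N] and genericity is used at
     [(i + r, s)]. *)
  move=> r s rs; have := gen (i + r)%N s.
  rewrite -addnA -ltn_subRL => /(_ rs).
  apply: contra => /eqP e; apply/eqP.
  have -> : a ^+ 2 * Q ^+ (i + r) = a * (a * Q ^+ i * Q ^+ r) by rewrite exprD; ring.
  by rewrite e mulVKf.
rewrite mulr_sumr; apply: eq_bigr => m _; rewrite /G addKn subnDA qpochD.
have -> : W * f a * f Q ^+ i = W * f (a * Q ^+ i).
  by rewrite -rmorphXn -mulrA -rmorphM.
rewrite [f (binomial_coef _ _ _ _ _ _ * _)]rmorphM.
by rewrite -[RHS]mulrA -[LHS]mulrA; congr (_ * _); rewrite mulrCA !mulrA.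
Qed.

(** [qpoch_rev] at [t = Q^(k+1)], where the reversed symbol is a quotient of two q-factorials. *)
Lemma qpoch_negpow i k :
  qpoch (Q ^- (i + k)) Q i
  = (\prod_(r < i) - Q ^+ r) * (Q ^- (i + k)) ^+ i * qpoch Q Q (i + k) / qpoch Q Q k.
Proof.
have -> : qpoch Q Q (i + k) = qpoch (Q * Q ^+ k) Q i * qpoch Q Q k.
  by rewrite addnC qpochD mulrC.
have -> : Q ^- (i + k) = Q / (Q ^+ i * (Q * Q ^+ k)).
  by rewrite exprD; field; rewrite Q0 !expf_neq0.
by rewrite qpoch_rev ?mulf_neq0 ?expf_neq0 // -[RHS]mulrA mulfK ?qpochQ_neq0.
Qed.

(** The left side is the term of index [i] in [R_], prefactor included, written in [Q] and [c]. The
    sizes are parametrised by [i], [k], [m], [p] so that [n - i], [l - i] and [N - l] are variables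
    instead of truncated subtractions. *)
Lemma connection_term (a b c : F) i k m p (n := (i + k)%N) (l := (i + m)%N)
    (N := (i + (m + p))%N) (v := c / (a * b) * Q ^+ (N - n))
    (w := Q / (Q ^+ N * (c / (a * b)))) :
  a != 0 -> b != 0 -> c != 0 -> (n <= N)%N ->
  qpoch (c * a * b) Q i != 0 -> qpoch w Q i != 0 ->
  qpoch (a ^+ 2 / Q ^+ p) Q l != 0 -> qpoch (a ^- 2 / Q ^+ l) Q p != 0 ->
  qpoch (c * b / a) Q n != 0 ->
  Q ^- (l * p) * qbinom N l Q
  * (qpoch (c * a * b) Q l * qpoch (c * b / a) Q p * qpoch v Q n
     / (qpoch (a ^+ 2 / Q ^+ p) Q l * qpoch (a ^- 2 / Q ^+ l) Q p
        * qpoch (c * b / a) Q n))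
  * (qpoch (Q ^- n) Q i * qpoch (b ^+ 2 * Q ^+ n / Q ^+ N) Q i
     * qpoch (Q ^- l) Q i * qpoch (a ^+ 2 / Q ^+ p) Q i
     / (qpoch Q Q i * qpoch (Q ^- N) Q i * qpoch w Q i * qpoch (c * a * b) Q i)
     * Q ^+ i)
  = binomial_coef a b c n N i
    * connection_coef Q (c * b * Q ^+ i) (a * Q ^+ i) a^-1 m p.
Proof.
move=> a0 b0 c0 nN d1 d2 d3 d4 d5.
have w0 : c / (a * b) != 0 by rewrite mulf_neq0 ?invr_eq0 ?mulf_neq0.
rewrite /binomial_coef /connection_coef -/v /qbinom /qbinom_den.
have -> : (N - l = p)%N by rewrite /N /l addnA addKn.
have -> : (n - i = k)%N by rewrite addKn.
(* Reversed, the lower parameter [w] supplies [(v Q^k; Q)_i], which cuts the numerator [(v; Q)_n]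
   down to the [(v; Q)_k] of [binomial_coef]. *)
have wE : qpoch w Q i = (\prod_(r < i) - Q ^+ r) * w ^+ i * qpoch (v * Q ^+ k) Q i.
  have wE : w = Q / (Q ^+ i * (v * Q ^+ k)).
    rewrite /w /v -{1}(subnK nN) exprD /n exprD; field.
    by rewrite a0 b0 c0 !expf_neq0.
  rewrite [in LHS]wE qpoch_rev -?wE // /v !mulf_neq0 ?expf_neq0 ?invr_eq0 //.
  by rewrite mulf_neq0.
move: d2; rewrite wE /n /l /N !qpoch_negpow -/n -/l -/N.
rewrite !mulf_eq0 !negb_or => /andP[/andP[g0 wi0] vk0].
(* The monomials left by the four reversals (at [Q^-n], [Q^-l], [Q^-N] and [w]) and the argument
   [Q^i] of the series match because they are [i]-th powers of two equal quantities. *)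
have wN : (Q ^- n) ^+ i * (Q ^- l) ^+ i * Q ^+ i
    = v ^+ i * (Q ^+ p) ^+ i * ((Q ^- N) ^+ i * w ^+ i).
  rewrite -!exprMn; congr (_ ^+ i).
  rewrite /v /w -[N in _ * Q ^+ (N - n) * _]/N.
  have -> : Q ^+ N = Q ^+ l * Q ^+ p by rewrite -exprD -addnA.
  have -> : Q ^+ (N - n) = Q ^+ l * Q ^+ p / Q ^+ n.
    by rewrite -exprD /l -addnA -[(i + _)%N]/N -{2}(subnK nN) exprD mulfK ?expf_neq0.
  by field; rewrite a0 b0 c0 !expf_neq0.
have -> : qpoch v Q n = qpoch v Q k * qpoch (v * Q ^+ k) Q i.
  by rewrite /n addnC qpochD.
have lE : forall z, qpoch z Q l = qpoch z Q i * qpoch (z * Q ^+ i) Q m.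
  by move=> z; rewrite qpochD.
move: d3; rewrite !(lE (c * a * b)) !(lE (a ^+ 2 / _)) mulf_eq0 negb_or => /andP[d31 d32].
have -> : c * b * Q ^+ i / a^-1 = c * a * b * Q ^+ i by rewrite invrK; ring.
have -> : c * b * Q ^+ i / (a * Q ^+ i) = c * b / a by field; rewrite a0 expf_neq0.
have -> : a * Q ^+ i / a^-1 / Q ^+ p = a ^+ 2 / Q ^+ p * Q ^+ i.
  by rewrite invrK; field; rewrite expf_neq0.
have -> : a^-1 / (a * Q ^+ i) / Q ^+ m = a ^- 2 / Q ^+ l.
  by rewrite exprD; field; rewrite a0 !expf_neq0.
have -> : Q ^+ (l * p) = (Q ^+ p) ^+ i * Q ^+ (m * p).
  by rewrite mulnDl exprD [(i * p)%N]mulnC exprM.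
have qn := qpochQ_neq0 _ _ Q_not_root1.
have qi := qn i; have qk := qn k; have qm := qn m; have qp := qn p.
have qN := qn N; have qmp := qn (m + p)%N; have qnn := qn n; have ql := qn l.
have [A20 A30 p0 mp0] : [/\ (Q ^- l) ^+ i != 0, (Q ^- N) ^+ i != 0,
    (Q ^+ p) ^+ i != 0 & Q ^+ (m * p) != 0].
  by split; rewrite ?expf_neq0 ?invr_eq0 ?expf_neq0.
have Qi0 : Q ^+ i != 0 by rewrite expf_neq0.
have -> : (Q ^- n) ^+ i = v ^+ i * (Q ^+ p) ^+ i * ((Q ^- N) ^+ i * w ^+ i)
    / ((Q ^- l) ^+ i * Q ^+ i).
  by rewrite -wN; field; rewrite A20 Qi0.
move: ((Q ^- l) ^+ i) A20 ((Q ^- N) ^+ i) A30 (w ^+ i) wi0 (v ^+ i) ((Q ^+ p) ^+ i) p0.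
move=> E1 E10 E2 E20 w1 wi0 v1 P p0.
clear wN wE lE.
move: d1 d31 d32 d4 d5 vk0 qi qk qm qp qN qmp qnn ql g0.
move: (qpoch (c * a * b) Q i) => x1.
move: (qpoch (a ^+ 2 / _) Q i) => x2.
move: (qpoch (a ^+ 2 / _ * _) Q m) => x3.
move: (qpoch (a ^- 2 / _) Q p) => x4.
move: (qpoch _ Q n) => x5.
move: (qpoch (v * _) Q i) => x6.
move: (qpoch Q Q i) (qpoch Q Q k) (qpoch Q Q m) (qpoch Q Q p) (qpoch Q Q N)
  (qpoch Q Q (m + p)) (qpoch Q Q n) (qpoch Q Q l) => y1 y2 y3 y4 y5 y6 y7 y8.
move: (bigop _ _ _) => g.
move: (qpoch _ _ _) (qpoch _ _ _) (qpoch _ _ _) (qpoch _ _ _) => t1 t2 t3 t4.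
move: (Q ^+ i) (Q ^+ (m * p)) Qi0 mp0 => X Y X0 Y0.
move=> h1 h2 h3 h4 h5 h6 k1 k2 k3 k4 k5 k6 k7 k8 g0.
field.
by rewrite h1 h2 h3 h4 h5 h6 k1 k2 k3 k4 k5 k6 k8 g0 X0 Y0 p0 E10 E20 wi0.
Qed.
End OneVariable.
Arguments generic {F}.
Arguments binomial_coef {F}.

(** * Identification of the connection coefficients with [R_] *)

Section RCoefficients.
Variables (F : fieldType) (q : F).
Hypothesis q0 : q != 0.
Hypothesis q_not_root1 : forall n, (0 < n)%N -> q ^+ n != 1.

Lemma sqr_not_root1 n : (0 < n)%N -> (q ^+ 2) ^+ n != 1.
Proof. by move=> n0; rewrite -exprM q_not_root1 // muln_gt0. Qed.

Lemma exprz_half_diff m n : q ^ (2 * m%:Z - 2 * n%:Z) = (q ^+ 2) ^+ m / (q ^+ 2) ^+ n.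
Proof.
rewrite expfzDr //; have tw k : (2 * k%:Z = (2 * k)%N)%R by rewrite PoszM.
by rewrite !tw -exprnP -exprnN -!exprM.
Qed.

Lemma exprz_neg_even n : q ^ (- 2 * n%:Z) = (q ^+ 2) ^- n.
Proof. by rewrite mulNr -[2 * n%:Z](PoszM 2) -exprnN -exprM. Qed.

(** A dictionary from the powers of [q] in [R_] to [Q] and [c], followed by [connection_term] in
    each summand. The range [i <= l] appears by itself, the series being terminated also by its
    parameter [Q^-l]. *)
Lemma R_connection (a b u : F) n l N (Q := q ^+ 2) (c := Q / q ^+ N / u ^+ 2) :
  a != 0 -> b != 0 -> u != 0 -> (n <= N)%N -> (l <= N)%N ->
  R_well_defined n l a b u N q ->
  R_ n l a b u N q =
  \sum_(i < n.+1 | (i <= l)%N) binomial_coef Q a b c n N i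
    * connection_coef Q (c * b * Q ^+ i) (a * Q ^+ i) a^-1 (l - i) (N - l).
Proof.
move=> a0 b0 u0 nN lN.
have Q0 : Q != 0 by rewrite expf_neq0.
have c0 : c != 0 by rewrite !mulf_neq0 ?invr_eq0 ?expf_neq0.
have Qn := sqr_not_root1.
have NE : N = (l + (N - l))%N by rewrite subnKC.
have e1 : q ^ (2 * l%:Z - 2 * N%:Z) = Q ^- (N - l).
  rewrite exprz_half_diff -/Q {1}NE exprD invfM mulrA mulfV ?mul1r //.
  by rewrite expf_neq0.
have eC : q ^ (2 - N%:Z) = q ^+ 2 / q ^+ N by rewrite expfzDr // -exprnN.
have ecab : q ^ (2 - N%:Z) * a * b * u ^- 2 = c * a * b.
  by rewrite eC /c /Q; field; rewrite u0 expf_neq0.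
have ecb : q ^ (2 - N%:Z) * a^-1 * b * u ^- 2 = c * b / a.
  by rewrite eC /c /Q; field; rewrite u0 a0 expf_neq0.
have ev : q ^ (2 + N%:Z - 2 * n%:Z) * a^-1 * b^-1 * u ^- 2
    = c / (a * b) * Q ^+ (N - n).
  have -> : q ^ (2 + N%:Z - 2 * n%:Z) = q ^+ 2 * q ^+ N / Q ^+ n.
    by rewrite !expfzDr // -[2 * n%:Z](PoszM 2) -exprnN -exprM.
  have -> : Q ^+ (N - n) = q ^+ N * q ^+ N / Q ^+ n.
    have -> : q ^+ N * q ^+ N = Q ^+ N by rewrite /Q -exprM mulnC exprM expr2.
    by rewrite -{2}(subnK nN) exprD mulfK ?expf_neq0.
  by rewrite /c /Q; field; rewrite u0 a0 b0 -exprM !expf_neq0.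
have ew : q ^ (- N%:Z) * a * b * u ^+ 2 = Q / (Q ^+ N * (c / (a * b))).
  rewrite -exprnN /c /Q -exprM mulnC exprM; field.
  by rewrite u0 a0 b0 q0 expf_neq0.
have et : q ^ (2 * n%:Z - 2 * N%:Z) * b ^+ 2 = b ^+ 2 * Q ^+ n / Q ^+ N.
  by rewrite exprz_half_diff -/Q mulrC mulrA.
have ea : q ^ (2 * l%:Z - 2 * N%:Z) * a ^+ 2 = a ^+ 2 / Q ^+ (N - l).
  by rewrite e1 mulrC.
have ea' : q ^ (- 2 * l%:Z) * a ^- 2 = a ^- 2 / Q ^+ l.
  by rewrite exprz_neg_even mulrC.
have ep : q ^ (2 * l%:Z * (l%:Z - N%:Z)) = Q ^- (l * (N - l)).
  have -> : 2 * l%:Z * (l%:Z - N%:Z) = - (2 * (l * (N - l)))%N%:Z.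
    by rewrite !PoszM -subzn //; ring.
  by rewrite -exprnN exprM.
rewrite /R_well_defined /R_ /Rden /phi43_den /phi43 -!/Q.
rewrite !ecab !ecb !ev !ew !et !ea !ea' ep !exprz_neg_even -!/Q.
case=> _; rewrite !mulf_eq0 !negb_or => /andP[/andP[d3 d4] d5] dphi.
rewrite mulr_sumr [RHS]big_mkcond /=; apply: eq_bigr => i _.
have ik : (i <= n)%N by rewrite -ltnS.
case: leqP => il; last first.
  (* For [l < i] this symbol contains the factor [1 - Q^-l Q^l]. *)
  suff -> : qpoch (Q ^- l) Q i = 0 by rewrite !(mulr0, mul0r).
  apply/eqP; rewrite qpoch_eq0; apply/existsP; exists (Ordinal il) => /=.
  by rewrite mulVf ?expf_neq0.
have := dphi i ik; rewrite !mulf_eq0 !negb_or => /andP[/andP[_ d2] d1].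
have := connection_term F Q Q0 Qn a b c i (n - i) (l - i) (N - l) a0 b0 c0.
cbv zeta.
have -> : (i + (l - i + (N - l)) = N)%N by rewrite addnA !subnKC.
by rewrite !subnKC // => <-.
Qed.


End RCoefficients.

(** * Expansion of [p_] at [q^-1], [b^-1] in the [p_] at [q], [a] *)

Section Expansion.
Variables (F : fieldType) (q s : F).
Hypothesis q0 : q != 0.
Hypothesis q_not_root1 : forall n, (0 < n)%N -> q ^+ n != 1.
Hypothesis s_sqrt_q : s ^+ 2 = q.

(** Since [s^N s^N = q^N], the two arguments [z s^N / u] and [W = z u s^-N] differ by the scalar
    [q^N / u^2]. Absorbing it and passing from base [Q^-1] to [Q] gives the left side of
    [connection_formula], with its two factors exchanged. *)
Lemma connection_expansion (A : comNzRingType) (f : {rmorphism F -> A}) (a b u : F) n N (z : A) :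
  a != 0 -> b != 0 -> u != 0 -> (n <= N)%N -> generic (q ^+ 2) a N ->
  (forall l, (l <= N)%N -> R_well_defined n l a b u N q) ->
  qpoch (z * f (s ^+ N * u^-1) * f b^-1) (f (q^-1 ^+ 2)) n
  * qpoch (z * f (s ^+ N * u^-1) * f b^-1^-1) (f (q^-1 ^+ 2)) (N - n) =
  \sum_(l < N.+1) f (R_ n l a b u N q)
    * (qpoch (z * f (u * s ^- N) * f a) (f (q ^+ 2)) l
       * qpoch (z * f (u * s ^- N) * f a^-1) (f (q ^+ 2)) (N - l)).
Proof.
move=> a0 b0 u0 nN gen wd.
pose Q := q ^+ 2; pose c := Q / q ^+ N / u ^+ 2.
have s0 : s != 0 by move: q0; rewrite -s_sqrt_q expf_eq0.
have Q0 : Q != 0 by rewrite expf_neq0.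
have Qn := sqr_not_root1 F q q_not_root1.
pose W := z * f (u * s ^- N).
have sN : s ^+ N * s ^+ N = q ^+ N by rewrite -s_sqrt_q -exprM mulnC exprM expr2.
have QN : q ^+ N * q ^+ N = Q ^+ N by rewrite /Q -exprM mulnC exprM expr2.
have WE x : z * f (s ^+ N * u^-1) * f x = W * f (q ^+ N / u ^+ 2 * x).
  rewrite -!mulrA -!rmorphM; congr (_ * f _); rewrite -sN; field.
  by rewrite u0 expf_neq0.
rewrite -/W !WE exprVn invrK -/Q !qpoch_inv_base //.
have -> : q ^+ N / u ^+ 2 / b * (Q / Q ^+ n) = c / b * Q ^+ (N - n).
  have -> : Q ^+ (N - n) = q ^+ N * q ^+ N / Q ^+ n.
    by rewrite QN -{2}(subnK nN) exprD mulfK ?expf_neq0.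
  by rewrite /c; field; rewrite u0 b0 !expf_neq0.
have -> : q ^+ N / u ^+ 2 * b * (Q / Q ^+ (N - n)) = c * b * Q ^+ n.
  have -> : Q ^+ n = q ^+ N * q ^+ N / Q ^+ (N - n).
    by rewrite QN -{1}(subnK nN) exprD mulrAC mulfV ?mul1r ?expf_neq0.
  by rewrite /c; field; rewrite u0 !expf_neq0.
(* This symbol is the last factor of [Rden], the same for every [l], so the instance [l = 0]
   suffices. *)
have den : qpoch (c * b / a) Q n != 0.
  have [_ + _] := wd 0%N (leq0n N); rewrite mulf_eq0 negb_or => /andP[_].
  rewrite expfzDr // -exprnN -[q ^ 2]/Q.
  suff -> : Q / q ^+ N * a^-1 * b * u ^- 2 = c * b / a by [].
  by rewrite /c; field; rewrite u0 a0 expf_neq0.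
rewrite mulrC (connection_formula F A f Q Q0 Qn a) //.
apply: eq_bigr => l _; congr (f _ * _).
have lN : (l <= N)%N by rewrite -ltnS.
by rewrite (R_connection F q q0 q_not_root1) //; apply: wd.
Qed.

Lemma p_expansion (a b u : F) n N (z : {poly {poly F}}) :
  a != 0 -> b != 0 -> u != 0 -> (n <= N)%N -> generic (q ^+ 2) a N ->
  (forall l, (l <= N)%N -> R_well_defined n l a b u N q) ->
  p_ n (z * cst (s ^+ N * u^-1)) b^-1 N q^-1 =
  \sum_(l < N.+1) cst (R_ n l a b u N q) * p_ l (z * cst (u * s ^- N)) a N q.
Proof. exact: (connection_expansion _ (polyC \o polyC)). Qed.

End Expansion.

(** * Bases of polynomials of bounded degree and bidegree *)

Section Bases.
Variable F : fieldType.
Implicit Types (p : {poly F}) (g : nat -> {poly F}).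

(** Only independence is asked: [N + 1] independent polynomials of degree at most [N] span by
    dimension. *)
Definition poly_basis (N : nat) (g : nat -> {poly F}) : Prop :=
  (forall n, (n <= N)%N -> (size (g n) <= N.+1)%N)
  /\ forall d : nat -> F, \sum_(n < N.+1) d n *: g n = 0 ->
       forall n, (n <= N)%N -> d n = 0.

(** The coefficient matrix is square with independent rows, hence invertible; the coordinates of [p]
    are its coefficient row times the inverse. *)
Lemma poly_basis_span N g p : poly_basis N g -> (size p <= N.+1)%N ->
  exists d : nat -> F, p = \sum_(n < N.+1) d n *: g n.
Proof.
case=> gN g_free pN.
pose M : 'M[F]_N.+1 := \matrix_(i, j) (g i)`_j.
have combE (v : 'rV[F]_N.+1) : rVpoly (v *m M) = \sum_(n < N.+1) v 0 n *: g n.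
  apply/polyP => j; rewrite coef_rVpoly coef_sum.
  case: insubP => [i _ <-|]; first by rewrite mxE; apply: eq_bigr => n _; rewrite mxE coefZ.
  rewrite -leqNgt => Nj; rewrite big1 // => n _.
  by rewrite coefZ nth_default ?mulr0 // (leq_trans _ Nj) // gN // -ltnS.
have Mfree : row_free M.
  apply: inj_row_free => v vM0; apply/rowP => n.
  have := combE v; rewrite vM0 linear0 => /esym h.
  have := g_free (fun n => v 0 (inord n)).
  under eq_bigr do rewrite inord_val.
  by move=> /(_ h n); rewrite inord_val mxE -ltnS; apply.
exists (fun n => (poly_rV p *m invmx M) 0 (inord n)).
under eq_bigr do rewrite inord_val.
by rewrite -combE mulmxKV -?row_free_unit // poly_rV_K.
Qed.

Lemma is_basis_intro N1 N2 (f : nat -> nat -> {poly {poly F}}) :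
  (forall (n1 : 'I_N1.+1) (n2 : 'I_N2.+1), tensor_space N1 N2 (f n1 n2)) ->
  (forall p : {poly {poly F}}, tensor_space N1 N2 p -> exists c : nat -> nat -> F,
     p = \sum_(l1 < N1.+1) \sum_(l2 < N2.+1) cst (c l1 l2) * f l1 l2) ->
  (forall c : nat -> nat -> F,
     \sum_(l1 < N1.+1) \sum_(l2 < N2.+1) cst (c l1 l2) * f l1 l2 = 0 ->
     forall (l1 : 'I_N1.+1) (l2 : 'I_N2.+1), c l1 l2 = 0) ->
  is_basis N1 N2 f.
Proof.
move=> fN f_span f_free; split=> // p /f_span[c pE].
exists (\matrix_(i, j) c i j); split.
  by rewrite pE; apply: eq_bigr => i _; apply: eq_bigr => j _; rewrite mxE.
move=> c' pE'; apply/matrixP => i j; rewrite mxE; apply/eqP; rewrite -subr_eq0; apply/eqP.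
have := f_free (fun i j => c i j - c' (inord i) (inord j)).
move=> /(_ _ i j); rewrite !inord_val; apply.
rewrite -[RHS](subrr p) {1}pE pE' -sumrB; apply: eq_bigr => k _.
rewrite -sumrB; apply: eq_bigr => l _.
by rewrite !inord_val /cst !polyCB mulrBl.
Qed.

Lemma tensor_space_prod N1 N2 p (g : {poly F}) : (size p <= N1.+1)%N -> (size g <= N2.+1)%N ->
  tensor_space N1 N2 (map_poly polyC p * g%:P).
Proof.
move=> pN gN; split=> [|i].
  by rewrite mulrC mul_polyC (leq_trans (size_scale_leq _ _)) // size_map_polyC.
by rewrite coefMC coef_map /= mul_polyC (leq_trans (size_scale_leq _ _)).
Qed.

(** The basis in [z1] may vary with [n2]. Each coefficient of [z1^i] is first expanded in [g]; the
    coordinates along [g n2] form a polynomial in [z1], expanded next in the basis attached to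
    [n2]. *)
Lemma tensor_basis_l N1 N2 (f : nat -> nat -> {poly F}) g :
  (forall n2, (n2 <= N2)%N -> poly_basis N1 (f^~ n2)) -> poly_basis N2 g ->
  is_basis N1 N2 (fun n1 n2 => map_poly polyC (f n1 n2) * (g n2)%:P).
Proof.
move=> fB gB; apply: is_basis_intro => [n1 n2|p [pN1 pN2]|c].
- have [fN _] := fB n2 (leq_ord n2); have [gN _] := gB.
  by apply: tensor_space_prod; [apply: fN|apply: gN]; apply: leq_ord.
- have [d dE] := fin_all_exists (fun i : 'I_N1.+1 => poly_basis_span N2 g p`_i gB (pN2 i)).
  pose h n2 : {poly F} := \poly_(i < N1.+1) d (inord i) n2.
  have [e eE] := fin_all_exists (fun n2 : 'I_N2.+1 =>
    poly_basis_span N1 _ (h n2) (fB n2 (leq_ord n2)) (size_poly _ _)).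
  exists (fun n1 n2 => e (inord n2) n1).
  rewrite exchange_big /=.
  rewrite (eq_bigr (fun n2 : 'I_N2.+1 => map_poly polyC (h n2) * (g n2)%:P)); last first.
    move=> n2 _; rewrite eE rmorph_sum mulr_suml; apply: eq_bigr => n1 _.
    by rewrite inord_val -mul_polyC rmorphM /= map_polyC mulrA.
  apply/polyP => i; rewrite coef_sum.
  have [iN|iN] := ltnP i N1.+1.
    rewrite [LHS](dE (Ordinal iN)); apply: eq_bigr => n2 _.
    rewrite coefMC coef_map /= coef_poly iN mul_polyC.
    by have -> : inord i = Ordinal iN by apply/val_inj; rewrite /= inordK.
  rewrite nth_default ?(leq_trans pN1) // big1 // => n2 _.
  by rewrite coefMC coef_map /= coef_poly ltnNge iN mul0r.
(* Independence: the coefficient of [z1^i] in the relation is a relation between the [g n2], so for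
   each [n2] the combination of the [f n1 n2] vanishes coefficientwise. *)
move=> c0 n1 n2; have [_ gF] := gB; have [_ fF] := fB n2 (leq_ord n2).
apply: (fF (c^~ n2)); last exact: leq_ord.
apply/polyP => i; rewrite coef0 coef_sum.
apply: (gF (fun n2 => (\sum_(n1 < N1.+1) (c n1 n2 *: f n1 n2)`_i))); last exact: leq_ord.
transitivity ((0 : {poly {poly F}})`_i); last by rewrite coef0.
rewrite -c0 exchange_big coef_sum; apply: eq_bigr => m2 _.
rewrite coef_sum scaler_suml; apply: eq_bigr => m1 _.
by rewrite mulrA coefMC coefCM coef_map /= -polyCM mul_polyC coefZ.
Qed.

(** The mirror case, with [z1] still the outer variable: the monomials [z1^i] are expanded in [f],
    and the polynomial in [z2] collected along [f n1] is expanded in the basis attached to [n1]. *)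
Lemma tensor_basis_r N1 N2 (f : nat -> {poly F}) (g : nat -> nat -> {poly F}) :
  poly_basis N1 f -> (forall n1, (n1 <= N1)%N -> poly_basis N2 (g n1)) ->
  is_basis N1 N2 (fun n1 n2 => map_poly polyC (f n1) * (g n1 n2)%:P).
Proof.
move=> fB gB; apply: is_basis_intro => [n1 n2|p [pN1 pN2]|c].
- have [gN _] := gB n1 (leq_ord n1); have [fN _] := fB.
  by apply: tensor_space_prod; [apply: fN|apply: gN]; apply: leq_ord.
- have XN (i : 'I_N1.+1) : (size ('X^i : {poly F}) <= N1.+1)%N by rewrite size_polyXn.
  have [d dE] := fin_all_exists (fun i : 'I_N1.+1 => poly_basis_span N1 f 'X^i fB (XN i)).
  pose h n1 : {poly F} := \sum_(i < N1.+1) d i n1 *: p`_i.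
  have hN n1 : (size (h n1) <= N2.+1)%N.
    apply: (leq_trans (size_sum _ _ _)); apply/bigmax_leqP => i _.
    exact: leq_trans (size_scale_leq _ _) (pN2 i).
  have [e eE] := fin_all_exists (fun n1 : 'I_N1.+1 =>
    poly_basis_span N2 _ (h n1) (gB n1 (leq_ord n1)) (hN n1)).
  exists (fun n1 n2 => e (inord n1) n2).
  rewrite (eq_bigr (fun n1 : 'I_N1.+1 => map_poly polyC (f n1) * (h n1)%:P)); last first.
    move=> n1 _; rewrite eE rmorph_sum mulr_sumr; apply: eq_bigr => n2 _.
    by rewrite inord_val /= -[_ *: _]mul_polyC polyCM mulrCA.
  transitivity (\sum_(i < N1.+1) (p`_i)%:P * map_poly polyC 'X^i).
    apply/polyP => i; rewrite coef_sum.
    have [iN|iN] := ltnP i N1.+1.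
      rewrite (bigD1 (Ordinal iN)) //= big1 => [|k /eqP ki].
        by rewrite addr0 coefCM map_polyXn coefXn eqxx mulr1.
      rewrite coefCM map_polyXn coefXn; case: eqP => [ik|]; last by rewrite mulr0.
      by case: ki; apply/val_inj.
    rewrite nth_default ?(leq_trans pN1) // big1 // => k _.
    rewrite coefCM map_polyXn coefXn; case: eqP => [ik|]; last by rewrite mulr0.
    by move: iN; rewrite ik leqNgt ltn_ord.
  rewrite (eq_bigr (fun i : 'I_N1.+1 =>
    \sum_(n < N1.+1) (p`_i)%:P * map_poly polyC (d i n *: f n))); last first.
    by move=> i _; rewrite -mulr_sumr -rmorph_sum /= -dE.
  rewrite exchange_big; apply: eq_bigr => n1 _ /=.
  rewrite rmorph_sum mulr_sumr; apply: eq_bigr => i _.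
  rewrite -[d i n1 *: f n1]mul_polyC rmorphM /= map_polyC.
  by rewrite -[d i n1 *: p`_i]mul_polyC polyCM mulrCA [RHS]mulrCA [_ * map_poly _ _]mulrC.
move=> c0 n1 n2; have [_ fF] := fB; have [_ gF] := gB n1 (leq_ord n1).
apply: (gF (c n1)); last exact: leq_ord.
apply/polyP => j; rewrite coef0 coef_sum.
apply: (fF (fun n1 => (\sum_(n2 < N2.+1) (c n1 n2 *: g n1 n2)`_j))); last exact: leq_ord.
apply/polyP => i.
transitivity ((0 : {poly {poly F}})`_i`_j); last by rewrite !coef0.
rewrite -c0 !coef_sum; apply: eq_bigr => m1 _.
rewrite !coef_sum coefZ mulr_suml; apply: eq_bigr => m2 _.
by rewrite mulrA coefMC coefCM coef_map /= -polyCM mul_polyC !coefZ mulrAC.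
Qed.

End Bases.

(** * One-variable eigenfunctions and their independence *)

Section Eigenfunctions.
Variables (F : fieldType).

(* [phi] is the function of [W = z c] underlying [p_ n (z * cst c) a N q]. *)
Definition phi (A : comNzRingType) (q a a' W : A) (n N : nat) : A :=
  qpoch (W * a) (q ^+ 2) n * qpoch (W * a') (q ^+ 2) (N - n).

Definition p_univ (q a c : F) (n N : nat) : {poly F} :=
  phi _ q%:P a%:P a^-1%:P ('X * c%:P) n N.

Lemma rmorph_phi (A B : comNzRingType) (f : {rmorphism A -> B}) q a a' W n N :
  f (phi A q a a' W n N) = phi B (f q) (f a) (f a') (f W) n N.
Proof. by rewrite /phi rmorphM !rmorph_qpoch rmorphXn !rmorphM. Qed.

Lemma cst_sqr (q : F) : cst (q ^+ 2) = cst q ^+ 2.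
Proof. by rewrite /cst !rmorphXn. Qed.

Lemma p_z1 (q a c : F) n N :
  p_ n (z1 F * cst c) a N q = map_poly polyC (p_univ q a c n N).
Proof.
rewrite /p_univ rmorph_phi rmorphM /= map_polyX !map_polyC /=.
by rewrite /phi /p_ cst_sqr.
Qed.

Lemma p_z2 (q a c : F) n N :
  p_ n (z2 F * cst c) a N q = (p_univ q a c n N)%:P.
Proof. by rewrite /p_univ rmorph_phi rmorphM /phi /p_ cst_sqr. Qed.

Lemma horner_p_univ (q a c x : F) n N :
  (p_univ q a c n N).[x] = phi F q a a^-1 (x * c) n N.
Proof.
rewrite -[LHS]/(horner_eval x (p_univ q a c n N)) rmorph_phi rmorphM.
by rewrite /= /horner_eval hornerX !hornerC.
Qed.

Lemma bieval_prod (p g : {poly F}) x y :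
  bieval (map_poly polyC p * g%:P) x y = p.[x] * g.[y].
Proof. by rewrite /bieval hornerM hornerC horner_map /= hornerM hornerC. Qed.

Lemma size_qpoch_linear (c Q : F) n : (size (qpoch ('X * c%:P) Q%:P n) <= n.+1)%N.
Proof.
elim: n => [|n IHn]; first by rewrite qpoch0 size_polyC oner_eq0.
have size2 : (size (1 - 'X * c%:P * Q%:P ^+ n : {poly F})%R <= 2)%N.
  rewrite (leq_trans (size_polyD _ _)) // geq_max size_polyC oner_eq0 size_polyN /=.
  rewrite -rmorphXn -mulrA -polyCM (leq_trans (size_polyMleq _ _)) // size_polyX size_polyC.
  by case: (_ == _).
rewrite qpochSr (leq_trans (size_polyMleq _ _)) // -subn1 leq_subLR add1n.
by rewrite (leq_trans (leq_add IHn size2)) // addn2.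
Qed.

(** At the node of index [r] every [p_n] with [n > r] vanishes. The value of [p_r] there is nonzero:
    its first symbol because [q] is not a root of unity, its second by genericity. *)
Lemma p_univ_basis (q a c : F) N : q != 0 -> a != 0 -> c != 0 ->
  (forall n, (0 < n)%N -> q ^+ n != 1) -> generic (q ^+ 2) a N ->
  poly_basis F N (fun n => p_univ q a c n N).
Proof.
move=> q0 a0 c0 qn gen; split=> [n nN|d d0].
  rewrite /p_univ /phi -!mulrA -!polyCM -!rmorphXn (leq_trans (size_polyMleq _ _)) //.
  rewrite -subn1 leq_subLR add1n -addn2.
  apply: (leq_trans (leq_add (size_qpoch_linear _ _ _) (size_qpoch_linear _ _ _))).
  by rewrite addSn addnS subnKC // addn2.
pose Q := q ^+ 2; have Q0 : Q != 0 by rewrite expf_neq0.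
(* The nodes 1/(c a Q^r) make the evaluation matrix triangular. *)
elim/ltn_ind=> r IHr rN.
have := congr1 (horner_eval ((c * a * Q ^+ r)^-1)) d0.
rewrite rmorph_sum [RHS]rmorph0 (bigD1 (Ordinal (rN : (r < N.+1)%N))) //= big1.
  rewrite addr0 /horner_eval hornerZ horner_p_univ => /eqP.
  rewrite mulf_eq0 => /orP[/eqP //|].
  have W1 : (c * a * Q ^+ r)^-1 * c * a = Q ^- r.
    by field; rewrite c0 a0 expf_neq0.
  have W2 : (c * a * Q ^+ r)^-1 * c * a^-1 = (a ^+ 2 * Q ^+ r)^-1.
    by field; rewrite c0 a0 expf_neq0.
  rewrite /phi W1 W2 mulf_eq0 !qpoch_eq0 => /orP[] /existsP[i /eqP e].
    have ir := ltn_ord i.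
    have := qn (2 * (r - i))%N; rewrite muln_gt0 subn_gt0 ir => /(_ isT).
    rewrite exprM -/Q; have := congr1 ( *%R (Q ^+ (r - i))) e.
    rewrite mulrCA -exprD subnK ?(ltnW ir) // mulVf ?expf_neq0 // mulr1 => <-.
    by rewrite eqxx.
  have := gen r i; rewrite -ltn_subRL ltn_ord => /(_ isT).
  have := congr1 ( *%R (a ^+ 2 * Q ^+ r)) e.
  by rewrite mulVKf ?mulf_neq0 ?expf_neq0 // mulr1 => <-; rewrite eqxx.
move=> n /eqP nr; rewrite /horner_eval hornerZ horner_p_univ.
have [nltr|rltn|enr] := ltngtP n r.
- by rewrite IHr ?mul0r // -ltnS.
- suff -> : phi F q a a^-1 ((c * a * Q ^+ r)^-1 * c) n N = 0 by rewrite mulr0.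
  apply/eqP; rewrite /phi mulf_eq0 qpoch_eq0; apply/orP; left.
  apply/existsP; exists (Ordinal rltn) => /=; apply/eqP.
  by rewrite -/Q; field; rewrite c0 a0 expf_neq0.
- by case: nr; apply/val_inj.
Qed.

Lemma thetaE (q a : F) n N : q != 0 ->
  theta q a (2 * n%:Z - N%:Z)
  = (q ^+ 2) ^+ n / q ^+ N * a + q ^+ N / (q ^+ 2) ^+ n * a^-1.
Proof.
move=> q0; rewrite /theta opprB !expfzDr // -[2 * n%:Z](PoszM 2) -!exprnN -!exprnP.
by rewrite !exprM.
Qed.

Lemma theta_shift (q a : F) (m k : int) : q != 0 ->
  theta q (a * q ^ k) m = theta q a (m + k).
Proof.
move=> q0; rewrite /theta opprD !expfzDr // invfM invr_expz; ring.
Qed.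

(** [theta] takes the same value at an argument [a q^m] and at its inverse, and the hypothesis makes
    [a q^(2i-M)] and [a q^(M-2k)] inverse to each other. Thus a failure of [generic] produces
    coinciding eigenvalues. *)
Lemma theta_reflect (q a : F) i k : q != 0 -> a != 0 ->
  a ^+ 2 * (q ^+ 2) ^+ i = (q ^+ 2) ^+ k ->
  forall M : int, theta q a (2 * i%:Z - M) = theta q a (M - 2 * k%:Z).
Proof.
move=> q0 a0 e M.
have qz m : q ^ (2 * m%:Z) = (q ^+ 2) ^+ m by rewrite -[2 * _](PoszM 2) -exprM.
rewrite /theta !opprB !expfzDr // -!invr_expz !qz -e.
have M0 : q ^ M != 0 by rewrite expfz_neq0.
by field; rewrite a0 M0 expf_neq0 // expf_neq0.
Qed.

(** The shift [W -> q^2 W] moves each symbol by one factor, so multiplying by the first factors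
    restores the original symbols with one factor more at the end. *)
Lemma phi_shift (q a a' W : F) n N :
  (1 - W * a) * (1 - W * a') * phi F q a a' (q ^+ 2 * W) n N
  = phi F q a a' W n N * (1 - W * a * (q ^+ 2) ^+ n) * (1 - W * a' * (q ^+ 2) ^+ (N - n)).
Proof.
rewrite /phi; set Q := q ^+ 2.
have e z m : (1 - W * z) * qpoch (Q * W * z) Q m = qpoch (W * z) Q m * (1 - W * z * Q ^+ m).
  by rewrite -qpochSr qpochS -mulrA [Q * _]mulrC.
rewrite mulrACA !e; ring.
Qed.

(** The operator carries [a] and the eigenfunction [a']; [G] is a spectator factor in the other
    variable. For [a' = a] the correction term disappears and this is the eigenvalue equation. *)
Lemma opA1_phi (q s a a' u : F) n N (f : F -> F -> F) (G : F -> F) :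
  q != 0 -> s ^+ 2 = q -> a != 0 -> a' != 0 -> u != 0 -> (n <= N)%N ->
  (forall x y, f x y = phi F q a' a'^-1 (x * (u * s ^- N)) n N * G y) ->
  forall x y, x != 0 ->
  opA1 q s a u N f x y = theta q a' (2 * n%:Z - N%:Z) * f x y
    - q ^- N * ((a' + a'^-1) - (a + a^-1)) * f (q ^ 1 * (q ^ 1 * x)) y.
Proof.
move=> q0 sq a0 a'0 u0 nN fE x y x0; rewrite /opA1 /shift1 thetaE // !fE.
have s0 : s != 0 by move: q0; rewrite -sq expf_eq0.
have S0 : s ^+ N != 0 by rewrite expf_neq0.
have qN : q ^+ N = s ^+ N ^+ 2 by rewrite -sq -!exprM mulnC.
have X0 : (q ^+ 2) ^+ n != 0 by rewrite !expf_neq0.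
have Y : (q ^+ 2) ^+ (N - n) = s ^+ N ^+ 4 / (q ^+ 2) ^+ n.
  have -> : s ^+ N ^+ 4 = (q ^+ 2) ^+ N by rewrite -sq -!exprM; congr (_ ^+ _); rewrite mulnA mulnC.
  by rewrite -{2}(subnK nN) exprD mulfK.
have -> : q ^ 1 * (q ^ 1 * x) * (u * s ^- N) = q ^+ 2 * (x * (u * s ^- N)).
  by rewrite expr1z; ring.
have := phi_shift q a' a'^-1 (x * (u * s ^- N)) n N; rewrite Y.
set W := x * (u * s ^- N).
move: (phi F q a' a'^-1 (q ^+ 2 * W) n N) (phi F q a' a'^-1 W n N) => P2 P; rewrite {}/W => key.
rewrite qN; move: (s ^+ N) ((q ^+ 2) ^+ n) S0 X0 key => S X S0 X0 key.
(* Since [(1 - W a) (1 - W / a)] and the same product at [a'] differ by a multiple of [W],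
   [phi_shift] applies at [a']. After division by [W S^2] the terms in [W^-1] and [W] cancel against
   the multiplication part of the operator, and the middle term is [theta]. *)
have E : (1 - x * u * S^-1 * a) * (1 - x * u * S^-1 * a^-1) * P2 =
    P * (1 - x * (u / S) * a' * X) * (1 - x * (u / S) * a'^-1 * (S ^+ 4 / X))
    + x * (u / S) * (a' + a'^-1 - (a + a^-1)) * P2.
  by rewrite -key; field; rewrite S0 a0 a'0.
have -> : u^-1 * S^-1 * x^-1 * (1 - x * u * S^-1 * a) * (1 - x * u * S^-1 * a^-1)
    * (P2 * G y) = u^-1 * S^-1 * x^-1
      * ((1 - x * u * S^-1 * a) * (1 - x * u * S^-1 * a^-1) * P2) * G y by ring.
rewrite E; field.
by rewrite ?S0 ?a0 ?a'0 ?u0 ?X0 ?x0.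
Qed.

End Eigenfunctions.

(** * Joint eigenbases [u] and [u_bar] *)

Section JointEigenbases.
Variable F : fieldType.
Implicit Types (q s a b u : F) (A B : (F -> F -> F) -> F -> F -> F).

Lemma is_basis_ext N1 N2 (f f' : nat -> nat -> {poly {poly F}}) :
  (forall n1 n2, f n1 n2 = f' n1 n2) -> is_basis N1 N2 f' -> is_basis N1 N2 f.
Proof.
move=> fE [fN fB]; split=> [n1 n2|p /fB[c [pE c_uniq]]]; first by rewrite fE.
have E d : \sum_(l1 < N1.+1) \sum_(l2 < N2.+1) cst (d l1 l2 : F) * f l1 l2
    = \sum_(l1 < N1.+1) \sum_(l2 < N2.+1) cst (d l1 l2) * f' l1 l2.
  by apply: eq_bigr => l1 _; apply: eq_bigr => l2 _; rewrite fE.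
by exists c; split=> [|c']; rewrite E //; apply: c_uniq.
Qed.

Lemma joint_eigenbasis_ext N1 N2 A B A' B' (ev ev' : nat -> nat -> F * F)
    (f f' : nat -> nat -> {poly {poly F}}) :
  (forall g x y, A g x y = A' g x y) -> (forall g x y, B g x y = B' g x y) ->
  (forall n1 n2, ev n1 n2 = ev' n1 n2) -> (forall n1 n2, f n1 n2 = f' n1 n2) ->
  joint_eigenbasis N1 N2 A' B' ev' f' -> joint_eigenbasis N1 N2 A B ev f.
Proof.
move=> AE BE evE fE [fB f_ev]; split; first exact: is_basis_ext fE fB.
by move=> n1 n2 x y x0 y0; rewrite AE BE evE fE; apply: f_ev.
Qed.

(** If [a^2 Q^i = Q^k] with [i + k < N], then [theta_reflect] identifies the eigenvalues of index
    [i] and [N - k], although [i < N - k]. The free offset [M] lets one coincidence serve for both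
    members of a pair of eigenvalues. *)
Lemma generic_theta q a N : q != 0 -> a != 0 ->
  (forall i k, (i <= N)%N -> (k <= N)%N ->
     (forall M : int, theta q a (2 * i%:Z - M) = theta q a (2 * k%:Z - (2 * N%:Z - M))) ->
     i = k) ->
  generic (q ^+ 2) a N.
Proof.
move=> q0 a0 theta_inj i k ikN; apply/negP => /eqP /(theta_reflect F q a i k q0 a0) e.
have kN : (k <= N)%N by apply: leq_trans (ltnW ikN); apply: leq_addl.
have := theta_inj i (N - k)%N; rewrite leq_subr (leq_trans (leq_addr k i) (ltnW ikN)).
move=> /(_ isT isT) ik; move: ikN; rewrite ik ?subnK ?ltnn // => M.
rewrite e; congr (theta _ _ _); rewrite -subzn //; ring.
Qed.

Lemma thetaV q a (m : int) : theta q^-1 a^-1 m = theta q a m.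
Proof. by rewrite /theta !exprz_inv opprK invrK addrC. Qed.

Lemma ev_u_generic q a N1 N2 : q != 0 -> a != 0 ->
  pairwise_distinct N1 N2 (ev_u q a N1 N2) ->
  generic (q ^+ 2) a N2
  /\ forall n2, (n2 <= N2)%N -> generic (q ^+ 2) (a * q ^ (2 * n2%:Z - N2%:Z)) N1.
Proof.
move=> q0 a0 dist; split=> [|n2 n2N]; apply: generic_theta => //.
- move=> i k iN kN e.
  (* The reflection also reverses the offset [N1] in the second eigenvalue, so the colliding pairs
     are [(0, i)] and [(N1, k)]. *)
  pose x : 'I_N1.+1 * 'I_N2.+1 := (ord0, Ordinal (iN : (i < N2.+1)%N)).
  pose y : 'I_N1.+1 * 'I_N2.+1 := (ord_max, Ordinal (kN : (k < N2.+1)%N)).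
  suff /dist[] : ev_u q a N1 N2 x.1 x.2 = ev_u q a N1 N2 y.1 y.2 by [].
  rewrite /ev_u /=; congr (_, _).
    by rewrite e; congr (theta _ _ _); ring.
  have -> : 2 * 0%:Z + 2 * i%:Z - N1%:Z - N2%:Z = 2 * i%:Z - (N1%:Z + N2%:Z) by ring.
  by rewrite e; congr (theta _ _ _); ring.
- by rewrite mulf_neq0 ?expfz_neq0.
move=> i k iN kN e.
pose x : 'I_N1.+1 * 'I_N2.+1 :=
  (Ordinal (iN : (i < N1.+1)%N), Ordinal (n2N : (n2 < N2.+1)%N)).
pose y : 'I_N1.+1 * 'I_N2.+1 :=
  (Ordinal (kN : (k < N1.+1)%N), Ordinal (n2N : (n2 < N2.+1)%N)).
suff /dist[] : ev_u q a N1 N2 x.1 x.2 = ev_u q a N1 N2 y.1 y.2 by [].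
rewrite /ev_u /=; congr (_, _).
have := e N1%:Z; rewrite !theta_shift // => e1.
have -> : 2 * i%:Z + 2 * n2%:Z - N1%:Z - N2%:Z
  = 2 * i%:Z - N1%:Z + (2 * n2%:Z - N2%:Z) by ring.
by rewrite e1; congr (theta _ _ _); ring.
Qed.

Lemma pairwise_distinct_swap N1 N2 (ev ev' : nat -> nat -> F * F) :
  (forall n1 n2, ev n1 n2 = ev' n2 n1) ->
  pairwise_distinct N1 N2 ev -> pairwise_distinct N2 N1 ev'.
Proof.
move=> evE dist [x1 x2] [y1 y2] /=; rewrite -!evE => e.
by have [-> ->] := dist (x2, x1) (y2, y1) e.
Qed.

Lemma ev_u_bar_swap q a N1 N2 n1 n2 : ev_u_bar q a N1 N2 n1 n2 = ev_u q a N2 N1 n2 n1.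
Proof. by rewrite /ev_u_bar /ev_u; congr (_, theta _ _ _); ring. Qed.

Lemma opA2_phi q s a a' u n N (f : F -> F -> F) (G : F -> F) :
  q != 0 -> s ^+ 2 = q -> a != 0 -> a' != 0 -> u != 0 -> (n <= N)%N ->
  (forall x y, f x y = phi F q a' a'^-1 (y * (u * s ^- N)) n N * G x) ->
  forall x y, y != 0 ->
  opA2 q s a u N f x y = theta q a' (2 * n%:Z - N%:Z) * f x y
    - q ^- N * ((a' + a'^-1) - (a + a^-1)) * f x (q ^ 1 * (q ^ 1 * y)).
Proof.
move=> q0 sq a0 a'0 u0 nN fE x y y0.
exact: (opA1_phi F q s a a' u n N (fun x y => f y x) G q0 sq a0 a'0 u0 nN).
Qed.

Lemma fuE q s a u1 u2 N1 N2 n1 n2 : fu q s a u1 u2 N1 N2 n1 n2 =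
  map_poly polyC (p_univ F q (a * q ^ (2 * n2%:Z - N2%:Z)) (u1 * s ^- N1) n1 N1)
  * (p_univ F q a (u2 * s ^- N2) n2 N2)%:P.
Proof. by rewrite /fu p_z1 p_z2. Qed.

Lemma fu_barE q s a u1 u2 N1 N2 n1 n2 : fu_bar q s a u1 u2 N1 N2 n1 n2 =
  map_poly polyC (p_univ F q a (u1 * s ^- N1) n1 N1)
  * (p_univ F q (a * q ^ (2 * n1%:Z - N1%:Z)) (u2 * s ^- N2) n2 N2)%:P.
Proof. by rewrite /fu_bar p_z1 p_z2. Qed.

Lemma joint_eigenbasis_u q s a u1 u2 N1 N2 : q != 0 ->
  (forall n, (0 < n)%N -> q ^+ n != 1) -> s ^+ 2 = q -> a != 0 -> u1 != 0 -> u2 != 0 ->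
  pairwise_distinct N1 N2 (ev_u q a N1 N2) ->
  joint_eigenbasis N1 N2 (opA2 q s a u2 N2) (opA12 q s a u1 u2 N1 N2)
    (ev_u q a N1 N2) (fu q s a u1 u2 N1 N2).
Proof.
move=> q0 qn sq a0 u10 u20 dist.
have s0 : s != 0 by move: q0; rewrite -sq expf_eq0.
have [gen2 gen1] := ev_u_generic q a N1 N2 q0 a0 dist.
have a'0 (m : int) : a * q ^ m != 0 by rewrite mulf_neq0 ?expfz_neq0.
have c0 u N : u != 0 -> u * s ^- N != 0.
  by move=> u0; rewrite mulf_neq0 ?invr_eq0 ?expf_neq0.
split.
  apply: (is_basis_ext _ _ _ _ (fuE q s a u1 u2 N1 N2)).
  apply: (tensor_basis_l F N1 N2 (fun n1 n2 =>
    p_univ F q (a * q ^ (2 * n2%:Z - N2%:Z)) (u1 * s ^- N1) n1 N1)).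
    by move=> n2 n2N; apply: p_univ_basis => //; [apply: c0|apply: gen1].
  by apply: p_univ_basis => //; apply: c0.
move=> n1 n2 x y x0 y0; set f := bieval _.
set a' := a * q ^ (2 * n2%:Z - N2%:Z).
have fE z t : f z t = phi F q a' a'^-1 (z * (u1 * s ^- N1)) n1 N1
    * phi F q a a^-1 (t * (u2 * s ^- N2)) n2 N2.
  by rewrite /f fuE bieval_prod !horner_p_univ.
have A2E z t : t != 0 -> opA2 q s a u2 N2 f z t = theta q a (2 * n2%:Z - N2%:Z) * f z t.
  move=> t0; rewrite (opA2_phi q s a a u2 n2 N2 f
    (fun z => phi F q a' a'^-1 (z * (u1 * s ^- N1)) n1 N1)) ?leq_ord //; first last.
    by move=> z' t'; rewrite fE mulrC.
  by rewrite subrr mulr0 mul0r subr0.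
split; first exact: A2E.
rewrite /opA12 (opA1_phi F q s a a' u1 n1 N1 f
  (fun t => phi F q a a^-1 (t * (u2 * s ^- N2)) n2 N2)) ?leq_ord ?a'0 //.
rewrite /shift1 A2E // /alpha /a' theta_shift //.
(* The eigenvalue of [A_2] is [a' + a'^-1], so the correction term of [opA1_phi] is the opposite of
   the coupling term. *)
have -> : theta q a (2 * n2%:Z - N2%:Z)
    = a * q ^ (2 * n2%:Z - N2%:Z) + (a * q ^ (2 * n2%:Z - N2%:Z))^-1.
  by rewrite /theta invfM -invr_expz; ring.
rewrite /ev_u /=.
have -> : 2 * n1%:Z + 2 * n2%:Z - N1%:Z - N2%:Z
  = 2 * n1%:Z - N1%:Z + (2 * n2%:Z - N2%:Z) by ring.
ring.
Qed.

Lemma joint_eigenbasis_u_bar q s a u1 u2 N1 N2 : q != 0 ->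
  (forall n, (0 < n)%N -> q ^+ n != 1) -> s ^+ 2 = q -> a != 0 -> u1 != 0 -> u2 != 0 ->
  pairwise_distinct N1 N2 (ev_u_bar q a N1 N2) ->
  joint_eigenbasis N1 N2 (opA1 q s a u1 N1) (opA21 q s a u1 u2 N1 N2)
    (ev_u_bar q a N1 N2) (fu_bar q s a u1 u2 N1 N2).
Proof.
move=> q0 qn sq a0 u10 u20.
move=> /(pairwise_distinct_swap _ _ _ _ (ev_u_bar_swap q a N1 N2)) dist.
have s0 : s != 0 by move: q0; rewrite -sq expf_eq0.
have [gen1 gen2] := ev_u_generic q a N2 N1 q0 a0 dist.
have a'0 (m : int) : a * q ^ m != 0 by rewrite mulf_neq0 ?expfz_neq0.
have c0 u N : u != 0 -> u * s ^- N != 0.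
  by move=> u0; rewrite mulf_neq0 ?invr_eq0 ?expf_neq0.
split.
  apply: (is_basis_ext _ _ _ _ (fu_barE q s a u1 u2 N1 N2)).
  apply: (tensor_basis_r F N1 N2 _ (fun n1 n2 =>
    p_univ F q (a * q ^ (2 * n1%:Z - N1%:Z)) (u2 * s ^- N2) n2 N2)).
    by apply: p_univ_basis => //; apply: c0.
  by move=> n1 n1N; apply: p_univ_basis => //; [apply: c0|apply: gen2].
move=> n1 n2 x y x0 y0; set f := bieval _.
set a' := a * q ^ (2 * n1%:Z - N1%:Z).
have fE z t : f z t = phi F q a a^-1 (z * (u1 * s ^- N1)) n1 N1
    * phi F q a' a'^-1 (t * (u2 * s ^- N2)) n2 N2.
  by rewrite /f fu_barE bieval_prod !horner_p_univ.
(* Stated for an arbitrary second factor [G] because in [A_21] the operator [A_1] acts on the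
   function already shifted in [z2]. *)
have A1E g G z t : (forall z t, g z t = phi F q a a^-1 (z * (u1 * s ^- N1)) n1 N1 * G t) ->
    z != 0 -> opA1 q s a u1 N1 g z t = theta q a (2 * n1%:Z - N1%:Z) * g z t.
  move=> gE z0; rewrite (opA1_phi F q s a a u1 n1 N1 g G) ?leq_ord //.
  by rewrite subrr mulr0 mul0r subr0.
split; first exact: A1E fE _.
rewrite /opA21 (opA2_phi q s a a' u2 n2 N2 f
  (fun z => phi F q a a^-1 (z * (u1 * s ^- N1)) n1 N1)) ?leq_ord ?a'0 //; first last.
  by move=> z t; rewrite fE mulrC.
cbv zeta; rewrite (A1E _ (fun t => q ^- N2 *
  phi F q a' a'^-1 (q ^ 1 * (q ^ 1 * t) * (u2 * s ^- N2)) n2 N2)) //; last first.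
  by move=> z t; rewrite /shift2 fE mulrCA.
rewrite /shift2 /alpha /a' theta_shift //.
have -> : theta q a (2 * n1%:Z - N1%:Z)
    = a * q ^ (2 * n1%:Z - N1%:Z) + (a * q ^ (2 * n1%:Z - N1%:Z))^-1.
  by rewrite /theta invfM -invr_expz; ring.
rewrite /ev_u_bar /=.
have -> : 2 * n1%:Z + 2 * n2%:Z - N1%:Z - N2%:Z
  = 2 * n2%:Z - N2%:Z + (2 * n1%:Z - N1%:Z) by ring.
ring.
Qed.

End JointEigenbases.

(** * Inversion of the parameters; the families [w], [w_bar], [v], [v_bar] *)

Section Inversion.
Variable F : fieldType.
Implicit Types (q s a b u : F).

Lemma opB1E q s b u N f x y : opB1 q s b u N f x y = opA1 q^-1 s^-1 b^-1 u^-1 N f x y.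
Proof. rewrite /opB1 /opA1 /shift1 !expr1z exprN1 !exprVn !invrK; ring. Qed.

Lemma opB2E q s b u N f x y : opB2 q s b u N f x y = opA2 q^-1 s^-1 b^-1 u^-1 N f x y.
Proof. rewrite /opB2 /opA2 /shift2 !expr1z exprN1 !exprVn !invrK; ring. Qed.

(** In [B_12] the operator on [z2] stands alone and the one on [z1] is coupled, as in [A_21]; this
    is why [w] corresponds to [u_bar] and [w_bar] to [u]. *)
Lemma opB12E q s b u1 u2 N1 N2 f x y : opB12 q s b u1 u2 N1 N2 f x y
  = opA21 q^-1 s^-1 b^-1 u1^-1 u2^-1 N1 N2 f x y.
Proof.
rewrite /opB12 /opA21; cbv zeta; rewrite opB1E opB2E /opA1 /opA2 /shift1 /shift2.
rewrite /alpha /beta !expr1z !exprN1 !exprVn !invrK; ring.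
Qed.

Lemma opB21E q s b u1 u2 N1 N2 f x y : opB21 q s b u1 u2 N1 N2 f x y
  = opA12 q^-1 s^-1 b^-1 u1^-1 u2^-1 N1 N2 f x y.
Proof.
rewrite /opB21 /opA12 /shift1 opB1E opB2E /opA1 /opA2 /shift1 /shift2.
rewrite /alpha /beta !expr1z !exprN1 !exprVn !invrK; ring.
Qed.

(** Puts the shifted parameter of [w] and [w_bar] in the inverted form that [p_expansion]
    expects. *)
Lemma mul_expzV q b (m n : int) : b^-1 * q ^ (n - m) = (b * q ^ (m - n))^-1.
Proof. by rewrite invfM invr_expz opprB. Qed.

Lemma fwE q s b u1 u2 N1 N2 n1 n2 : fw q s b u1 u2 N1 N2 n1 n2
  = fu_bar q^-1 s^-1 b^-1 u1^-1 u2^-1 N1 N2 n1 n2.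
Proof.
by rewrite /fw /fu_bar !exprVn !invrK exprz_inv opprB ![_^-1 * s ^+ _]mulrC.
Qed.

Lemma fw_barE q s b u1 u2 N1 N2 n1 n2 : fw_bar q s b u1 u2 N1 N2 n1 n2
  = fu q^-1 s^-1 b^-1 u1^-1 u2^-1 N1 N2 n1 n2.
Proof.
by rewrite /fw_bar /fu !exprVn !invrK exprz_inv opprB ![_^-1 * s ^+ _]mulrC.
Qed.

Lemma ev_wE q b N1 N2 n1 n2 : ev_w q b N1 N2 n1 n2 = ev_u_bar q^-1 b^-1 N1 N2 n1 n2.
Proof. by rewrite /ev_w /ev_u_bar !thetaV. Qed.

Lemma ev_w_barE q b N1 N2 n1 n2 : ev_w_bar q b N1 N2 n1 n2 = ev_u q^-1 b^-1 N1 N2 n1 n2.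
Proof. by rewrite /ev_w_bar /ev_u !thetaV. Qed.

Lemma pairwise_distinct_ext N1 N2 (ev ev' : nat -> nat -> F * F) :
  (forall n1 n2, ev n1 n2 = ev' n1 n2) ->
  pairwise_distinct N1 N2 ev -> pairwise_distinct N1 N2 ev'.
Proof. by move=> evE dist x y e; apply: dist; rewrite !evE. Qed.

Lemma invr_not_root1 q : (forall n, (0 < n)%N -> q ^+ n != 1) ->
  forall n, (0 < n)%N -> q^-1 ^+ n != 1.
Proof. by move=> qn n n0; rewrite exprVn invr_eq1 qn. Qed.

Lemma joint_eigenbasis_w q s b u1 u2 N1 N2 : q != 0 ->
  (forall n, (0 < n)%N -> q ^+ n != 1) -> s ^+ 2 = q -> b != 0 -> u1 != 0 -> u2 != 0 ->
  pairwise_distinct N1 N2 (ev_w q b N1 N2) ->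
  joint_eigenbasis N1 N2 (opB1 q s b u1 N1) (opB12 q s b u1 u2 N1 N2)
    (ev_w q b N1 N2) (fw q s b u1 u2 N1 N2).
Proof.
move=> q0 qn sq b0 u10 u20 /(pairwise_distinct_ext _ _ _ _ (ev_wE q b N1 N2)) dist.
apply: joint_eigenbasis_ext (opB1E _ _ _ _ _) (opB12E _ _ _ _ _ _ _) (ev_wE _ _ _ _)
  (fwE _ _ _ _ _ _ _) _.
apply: joint_eigenbasis_u_bar; rewrite ?invr_eq0 ?exprVn ?sq //.
exact: invr_not_root1.
Qed.

Lemma joint_eigenbasis_w_bar q s b u1 u2 N1 N2 : q != 0 ->
  (forall n, (0 < n)%N -> q ^+ n != 1) -> s ^+ 2 = q -> b != 0 -> u1 != 0 -> u2 != 0 ->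
  pairwise_distinct N1 N2 (ev_w_bar q b N1 N2) ->
  joint_eigenbasis N1 N2 (opB2 q s b u2 N2) (opB21 q s b u1 u2 N1 N2)
    (ev_w_bar q b N1 N2) (fw_bar q s b u1 u2 N1 N2).
Proof.
move=> q0 qn sq b0 u10 u20 /(pairwise_distinct_ext _ _ _ _ (ev_w_barE q b N1 N2)) dist.
apply: joint_eigenbasis_ext (opB2E _ _ _ _ _) (opB21E _ _ _ _ _ _ _) (ev_w_barE _ _ _ _)
  (fw_barE _ _ _ _ _ _ _) _.
apply: joint_eigenbasis_u; rewrite ?invr_eq0 ?exprVn ?sq //.
exact: invr_not_root1.
Qed.

(** Each variable has its own base, so that taking one of the two bases to be [q^-1] gives [v] and
    [v_bar]. Genericity in one variable comes from pairs whose other index is 0. *)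
Lemma decoupled_eigenbasis q q' s s' a b u1 u2 N1 N2 : q != 0 -> q' != 0 ->
  (forall n, (0 < n)%N -> q ^+ n != 1) -> (forall n, (0 < n)%N -> q' ^+ n != 1) ->
  s ^+ 2 = q -> s' ^+ 2 = q' -> a != 0 -> b != 0 -> u1 != 0 -> u2 != 0 ->
  pairwise_distinct N1 N2 (fun n1 n2 =>
    (theta q a (2 * n1%:Z - N1%:Z), theta q' b (2 * n2%:Z - N2%:Z))) ->
  joint_eigenbasis N1 N2 (opA1 q s a u1 N1) (opA2 q' s' b u2 N2)
    (fun n1 n2 => (theta q a (2 * n1%:Z - N1%:Z), theta q' b (2 * n2%:Z - N2%:Z)))
    (fun n1 n2 => map_poly polyC (p_univ F q a (u1 * s ^- N1) n1 N1)
       * (p_univ F q' b (u2 * s' ^- N2) n2 N2)%:P).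
Proof.
move=> q0 q'0 qn q'n sq sq' a0 b0 u10 u20 dist.
have s0 : s != 0 by move: q0; rewrite -sq expf_eq0.
have s'0 : s' != 0 by move: q'0; rewrite -sq' expf_eq0.
have bounds (k N : nat) : 2 * k%:Z - (2 * N%:Z - N%:Z) = 2 * k%:Z - N%:Z by ring.
split.
  apply: (tensor_basis_l F N1 N2 (fun n1 _ => p_univ F q a (u1 * s ^- N1) n1 N1)
            (fun n2 => p_univ F q' b (u2 * s' ^- N2) n2 N2)) => [n2 n2N|].
    apply: p_univ_basis; rewrite ?mulf_neq0 ?invr_eq0 ?expf_neq0 //.
    apply: generic_theta => // i k iN kN e.
    pose x : 'I_N1.+1 * 'I_N2.+1 := (Ordinal (iN : (i < N1.+1)%N), ord0).
    pose y : 'I_N1.+1 * 'I_N2.+1 := (Ordinal (kN : (k < N1.+1)%N), ord0).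
    suff /dist[] : (fun n : 'I_N1.+1 * 'I_N2.+1 => (theta q a (2 * n.1%:Z - N1%:Z),
      theta q' b (2 * n.2%:Z - N2%:Z))) x = (theta q a (2 * y.1%:Z - N1%:Z),
      theta q' b (2 * y.2%:Z - N2%:Z)) by [].
    by rewrite /= e bounds.
  apply: p_univ_basis; rewrite ?mulf_neq0 ?invr_eq0 ?expf_neq0 //.
  apply: generic_theta => // i k iN kN e.
  pose x : 'I_N1.+1 * 'I_N2.+1 := (ord0, Ordinal (iN : (i < N2.+1)%N)).
  pose y : 'I_N1.+1 * 'I_N2.+1 := (ord0, Ordinal (kN : (k < N2.+1)%N)).
  suff /dist[] : (fun n : 'I_N1.+1 * 'I_N2.+1 => (theta q a (2 * n.1%:Z - N1%:Z),
      theta q' b (2 * n.2%:Z - N2%:Z))) x = (theta q a (2 * y.1%:Z - N1%:Z),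
      theta q' b (2 * y.2%:Z - N2%:Z)) by [].
    by rewrite /= e bounds.
move=> n1 n2 x y x0 y0; set f := bieval _.
have fE z t : f z t = phi F q a a^-1 (z * (u1 * s ^- N1)) n1 N1
    * phi F q' b b^-1 (t * (u2 * s' ^- N2)) n2 N2.
  by rewrite /f bieval_prod !horner_p_univ.
split; rewrite /=.
  rewrite (opA1_phi F q s a a u1 n1 N1 f
    (fun t => phi F q' b b^-1 (t * (u2 * s' ^- N2)) n2 N2)) ?leq_ord //.
  by rewrite subrr mulr0 mul0r subr0.
rewrite (opA2_phi F q' s' b b u2 n2 N2 f
  (fun z => phi F q a a^-1 (z * (u1 * s ^- N1)) n1 N1)) ?leq_ord //; first last.
  by move=> z t; rewrite fE mulrC.
by rewrite subrr mulr0 mul0r subr0.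
Qed.

Lemma joint_eigenbasis_sym N1 N2 (A B : (F -> F -> F) -> F -> F -> F) ev f :
  joint_eigenbasis N1 N2 A B (fun n1 n2 => ((ev n1 n2).2, (ev n1 n2).1)) f ->
  joint_eigenbasis N1 N2 B A ev f.
Proof. by case=> fB fE; split=> // n1 n2 x y x0 y0; have [] := fE n1 n2 x y x0 y0. Qed.

Lemma joint_eigenbasis_v q s a b u1 u2 N1 N2 : q != 0 ->
  (forall n, (0 < n)%N -> q ^+ n != 1) -> s ^+ 2 = q -> a != 0 -> b != 0 ->
  u1 != 0 -> u2 != 0 ->
  pairwise_distinct N1 N2 (ev_v q a b N1 N2) ->
  joint_eigenbasis N1 N2 (opA2 q s a u2 N2) (opB1 q s b u1 N1)
    (ev_v q a b N1 N2) (fv q s a b u1 u2 N1 N2).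
Proof.
move=> q0 qn sq a0 b0 u10 u20 dist.
have dist' : pairwise_distinct N1 N2 (fun n1 n2 =>
    (theta q^-1 b^-1 (2 * n1%:Z - N1%:Z), theta q a (2 * n2%:Z - N2%:Z))).
  by move=> x y; rewrite !thetaV => -[e1 e2]; apply: dist; rewrite /ev_v e1 e2.
apply: joint_eigenbasis_sym.
apply: joint_eigenbasis_ext (opB1E _ _ _ _ _) _ _ _
  (decoupled_eigenbasis q^-1 q s^-1 s b^-1 a u1^-1 u2 N1 N2 _ _ _ _ _ _ _ _ _ _ dist');
  rewrite ?invr_eq0 ?exprVn ?sq //.
- by move=> n1 n2; rewrite thetaV.
- move=> n1 n2; rewrite /fv p_z2 -p_z1 invrK.
  by rewrite [u1^-1 * _]mulrC.
- exact: invr_not_root1.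
Qed.

Lemma joint_eigenbasis_v_bar q s a b u1 u2 N1 N2 : q != 0 ->
  (forall n, (0 < n)%N -> q ^+ n != 1) -> s ^+ 2 = q -> a != 0 -> b != 0 ->
  u1 != 0 -> u2 != 0 ->
  pairwise_distinct N1 N2 (ev_v_bar q a b N1 N2) ->
  joint_eigenbasis N1 N2 (opA1 q s a u1 N1) (opB2 q s b u2 N2)
    (ev_v_bar q a b N1 N2) (fv_bar q s a b u1 u2 N1 N2).
Proof.
move=> q0 qn sq a0 b0 u10 u20 dist.
have dist' : pairwise_distinct N1 N2 (fun n1 n2 =>
    (theta q a (2 * n1%:Z - N1%:Z), theta q^-1 b^-1 (2 * n2%:Z - N2%:Z))).
  by move=> x y; rewrite !thetaV => -[e1 e2]; apply: dist; rewrite /ev_v_bar e1 e2.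
apply: joint_eigenbasis_ext _ (opB2E _ _ _ _ _) _ _
  (decoupled_eigenbasis q q^-1 s s^-1 a b^-1 u1 u2^-1 N1 N2 _ _ _ _ _ _ _ _ _ _ dist');
  rewrite ?invr_eq0 ?exprVn ?sq //.
- by move=> n1 n2; rewrite thetaV.
- move=> n1 n2; rewrite /fv_bar p_z1 -p_z2 invrK.
  by rewrite [u2^-1 * _]mulrC.
- exact: invr_not_root1.
Qed.

End Inversion.

(** * The four overlap expansions *)

Section Overlaps.
Variable F : fieldType.

Lemma prod_expansion_l (A : comNzRingType) N1 N2 (x y : A) (d g : nat -> A)
    (c f : nat -> nat -> A) :
  y = \sum_(l2 < N2.+1) d l2 * g l2 ->
  (forall l2 : 'I_N2.+1, x = \sum_(l1 < N1.+1) c l1 l2 * f l1 l2) ->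
  x * y = \sum_(l1 < N1.+1) \sum_(l2 < N2.+1) c l1 l2 * d l2 * (f l1 l2 * g l2).
Proof.
move=> -> xE; rewrite exchange_big mulr_sumr; apply: eq_bigr => l2 _.
by rewrite (xE l2) mulr_suml; apply: eq_bigr => l1 _; rewrite mulrACA.
Qed.

Lemma prod_expansion_r (A : comNzRingType) N1 N2 (x y : A) (c f : nat -> A)
    (d g : nat -> nat -> A) :
  x = \sum_(l1 < N1.+1) c l1 * f l1 ->
  (forall l1 : 'I_N1.+1, y = \sum_(l2 < N2.+1) d l1 l2 * g l1 l2) ->
  x * y = \sum_(l1 < N1.+1) \sum_(l2 < N2.+1) c l1 * d l1 l2 * (f l1 * g l1 l2).
Proof.
move=> -> yE; rewrite mulr_suml; apply: eq_bigr => l1 _.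
by rewrite (yE l1) mulr_sumr; apply: eq_bigr => l2 _; rewrite mulrACA.
Qed.

Lemma cstM (x y : F) : cst (x * y) = cst x * cst y.
Proof. by rewrite /cst !polyCM. Qed.

End Overlaps.

(** Each overlap is one [p_expansion] per variable. The variable whose target basis carries the
    unshifted [a] is expanded first; its summation index then fixes the shift of [a] in the other
    one, while the shift of [b] is fixed by [k1] or [k2]. Distinctness of the eigenvalues of [u] and
    [u_bar] supplies genericity. *)
Lemma overlap_expansions (F : fieldType) (q s a b u1 u2 : F) (N1 N2 : nat)
  (q_neq0 : q != 0)
  (q_not_root1 : forall n : nat, (0 < n)%N -> q ^+ n != 1)
  (s_sqrt_q : s ^+ 2 = q)
  (a_neq0 : a != 0) (b_neq0 : b != 0) (u1_neq0 : u1 != 0) (u2_neq0 : u2 != 0)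
  (dist_u : pairwise_distinct N1 N2 (ev_u q a N1 N2))
  (dist_u_bar : pairwise_distinct N1 N2 (ev_u_bar q a N1 N2))
  (coefs_ok : forall (k1 l1 : 'I_N1.+1) (k2 l2 : 'I_N2.+1),
     coefs_well_defined q a b u1 u2 N1 N2 k1 k2 l1 l2)
   (k1 : 'I_N1.+1) (k2 : 'I_N2.+1) :
  let u := fu q s a u1 u2 N1 N2 in
  let w := fw q s b u1 u2 N1 N2 in
  let u_bar := fu_bar q s a u1 u2 N1 N2 in
  let w_bar := fw_bar q s b u1 u2 N1 N2 in
     [/\ w k1 k2 = \sum_(l1 < N1.+1) \sum_(l2 < N2.+1)
                     cst (coefT q a b u1 u2 N1 N2 k1 k2 l1 l2) * u l1 l2,
         w_bar k1 k2 = \sum_(l1 < N1.+1) \sum_(l2 < N2.+1)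
                         cst (coefS q a b u1 u2 N1 N2 k1 k2 l1 l2) * u l1 l2,
         w_bar k1 k2 = \sum_(l1 < N1.+1) \sum_(l2 < N2.+1)
                         cst (coefT_bar q a b u1 u2 N1 N2 k1 k2 l1 l2) * u_bar l1 l2
       & w k1 k2 = \sum_(l1 < N1.+1) \sum_(l2 < N2.+1)
                     cst (coefS_bar q a b u1 u2 N1 N2 k1 k2 l1 l2) * u_bar l1 l2].
Proof.
have [gen2 gen1] := ev_u_generic F q a N1 N2 q_neq0 a_neq0 dist_u.
have [gen1' gen2'] := ev_u_generic F q a N2 N1 q_neq0 a_neq0
  (pairwise_distinct_swap F _ _ _ _ (ev_u_bar_swap F q a N1 N2) dist_u_bar).
have shift0 (c : F) (m : int) : c != 0 -> c * q ^ m != 0.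
  by move=> c0; rewrite mulf_neq0 ?expfz_neq0.
pose expand := p_expansion F q s q_neq0 q_not_root1 s_sqrt_q.
have ok l1 l2 : (l1 <= N1)%N -> (l2 <= N2)%N ->
    coefs_well_defined q a b u1 u2 N1 N2 k1 k2 l1 l2.
  move=> l1N l2N.
  exact: (coefs_ok k1 (Ordinal (l1N : (l1 < N1.+1)%N))
            k2 (Ordinal (l2N : (l2 < N2.+1)%N))).
have [k1N k2N] := (leq_ord k1, leq_ord k2).
cbv zeta; split.
- rewrite /fw /coefT /fu mul_expzV.
  under eq_bigr do under eq_bigr do rewrite cstM.
  apply: (prod_expansion_l _ N1 N2 _ _
    (fun l2 => cst (R_ k2 l2 a (b * q ^ (2 * k1%:Z - N1%:Z)) u2 N2 q))
    (fun l2 => p_ l2 (z2 F * cst (u2 * s ^- N2)) a N2 q)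
    (fun l1 l2 => cst (R_ k1 l1 (a * q ^ (2 * l2%:Z - N2%:Z)) b u1 N1 q))
    (fun l1 l2 => p_ l1 (z1 F * cst (u1 * s ^- N1)) (a * q ^ (2 * l2%:Z - N2%:Z)) N1 q)).
    apply: expand => // [|l lN]; first exact: shift0.
    (* The condition on the [z2] factor is the same for all [l1], so [l1 = 0] is taken. *)
    by have [[_ ?] _ _ _] := ok 0%N l (leq0n _) lN.
  move=> l2; apply: expand => // [||l lN]; first exact: shift0.
    exact: gen1 (leq_ord l2).
  by have [[? _] _ _ _] := ok l l2 lN (leq_ord l2).
- rewrite /fw_bar /coefS /fu mul_expzV.
  under eq_bigr do under eq_bigr do rewrite cstM.
  apply: (prod_expansion_l _ N1 N2 _ _
    (fun l2 => cst (R_ k2 l2 a b u2 N2 q))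
    (fun l2 => p_ l2 (z2 F * cst (u2 * s ^- N2)) a N2 q)
    (fun l1 l2 => cst (R_ k1 l1 (a * q ^ (2 * l2%:Z - N2%:Z))
                             (b * q ^ (2 * k2%:Z - N2%:Z)) u1 N1 q))
    (fun l1 l2 => p_ l1 (z1 F * cst (u1 * s ^- N1)) (a * q ^ (2 * l2%:Z - N2%:Z)) N1 q)).
    apply: expand => // l lN.
    by have [_ [_ ?] _ _] := ok 0%N l (leq0n _) lN.
  move=> l2; apply: expand => // [|||l lN]; try exact: shift0.
    exact: gen1 (leq_ord l2).
  by have [_ [? _] _ _] := ok l l2 lN (leq_ord l2).
- rewrite /fw_bar /coefT_bar /fu_bar mul_expzV.
  under eq_bigr do under eq_bigr do rewrite cstM.
  apply: (prod_expansion_r _ N1 N2 _ _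
    (fun l1 => cst (R_ k1 l1 a (b * q ^ (2 * k2%:Z - N2%:Z)) u1 N1 q))
    (fun l1 => p_ l1 (z1 F * cst (u1 * s ^- N1)) a N1 q)
    (fun l1 l2 => cst (R_ k2 l2 (a * q ^ (2 * l1%:Z - N1%:Z)) b u2 N2 q))
    (fun l1 l2 => p_ l2 (z2 F * cst (u2 * s ^- N2)) (a * q ^ (2 * l1%:Z - N1%:Z)) N2 q)).
    apply: expand => // [|l lN]; first exact: shift0.
    by have [_ _ [? _] _] := ok l 0%N lN (leq0n _).
  move=> l1; apply: expand => // [||l lN]; first exact: shift0.
    exact: gen2' (leq_ord l1).
  by have [_ _ [_ ?] _] := ok l1 l (leq_ord l1) lN.
- rewrite /fw /coefS_bar /fu_bar mul_expzV.
  under eq_bigr do under eq_bigr do rewrite cstM.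
  apply: (prod_expansion_r _ N1 N2 _ _
    (fun l1 => cst (R_ k1 l1 a b u1 N1 q))
    (fun l1 => p_ l1 (z1 F * cst (u1 * s ^- N1)) a N1 q)
    (fun l1 l2 => cst (R_ k2 l2 (a * q ^ (2 * l1%:Z - N1%:Z))
                             (b * q ^ (2 * k1%:Z - N1%:Z)) u2 N2 q))
    (fun l1 l2 => p_ l2 (z2 F * cst (u2 * s ^- N2)) (a * q ^ (2 * l1%:Z - N1%:Z)) N2 q)).
    apply: expand => // l lN.
    by have [_ _ _ [? _]] := ok l 0%N lN (leq0n _).
  move=> l1; apply: expand => // [|||l lN]; try exact: shift0.
    exact: gen2' (leq_ord l1).
  by have [_ _ _ [_ ?]] := ok l1 l (leq_ord l1) lN.
Qed.

Theorem theorem3p7 (R : realType) (q s a b u1 u2 : R[i]) (N1 N2 : nat)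
  (q_neq0 : q != 0)
  (q_not_root1 : forall n : nat, (0 < n)%N -> q ^+ n != 1)
  (s_sqrt_q : s ^+ 2 = q)
  (a_neq0 : a != 0) (b_neq0 : b != 0) (u1_neq0 : u1 != 0) (u2_neq0 : u2 != 0)
  (dist_u : pairwise_distinct N1 N2 (ev_u q a N1 N2))
  (dist_v : pairwise_distinct N1 N2 (ev_v q a b N1 N2))
  (dist_w : pairwise_distinct N1 N2 (ev_w q b N1 N2))
  (dist_u_bar : pairwise_distinct N1 N2 (ev_u_bar q a N1 N2))
  (dist_v_bar : pairwise_distinct N1 N2 (ev_v_bar q a b N1 N2))
  (dist_w_bar : pairwise_distinct N1 N2 (ev_w_bar q b N1 N2))
  (coefs_ok : forall (k1 l1 : 'I_N1.+1) (k2 l2 : 'I_N2.+1),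
     coefs_well_defined q a b u1 u2 N1 N2 k1 k2 l1 l2) :
  let A1 := opA1 q s a u1 N1 in
  let A2 := opA2 q s a u2 N2 in
  let B1 := opB1 q s b u1 N1 in
  let B2 := opB2 q s b u2 N2 in
  let A12 := opA12 q s a u1 u2 N1 N2 in
  let B12 := opB12 q s b u1 u2 N1 N2 in
  let A21 := opA21 q s a u1 u2 N1 N2 in
  let B21 := opB21 q s b u1 u2 N1 N2 in
  let u := fu q s a u1 u2 N1 N2 in
  let v := fv q s a b u1 u2 N1 N2 in
  let w := fw q s b u1 u2 N1 N2 in
  let u_bar := fu_bar q s a u1 u2 N1 N2 in
  let v_bar := fv_bar q s a b u1 u2 N1 N2 in
  let w_bar := fw_bar q s b u1 u2 N1 N2 in
  let T := coefT q a b u1 u2 N1 N2 in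
  let S := coefS q a b u1 u2 N1 N2 in
  let T_bar := coefT_bar q a b u1 u2 N1 N2 in
  let S_bar := coefS_bar q a b u1 u2 N1 N2 in
  [/\ joint_eigenbasis N1 N2 A2 A12 (ev_u q a N1 N2) u,
      joint_eigenbasis N1 N2 A2 B1 (ev_v q a b N1 N2) v
    & joint_eigenbasis N1 N2 B1 B12 (ev_w q b N1 N2) w]
  /\ [/\ joint_eigenbasis N1 N2 A1 A21 (ev_u_bar q a N1 N2) u_bar,
         joint_eigenbasis N1 N2 A1 B2 (ev_v_bar q a b N1 N2) v_bar
       & joint_eigenbasis N1 N2 B2 B21 (ev_w_bar q b N1 N2) w_bar]
  /\ forall (k1 : 'I_N1.+1) (k2 : 'I_N2.+1),
     [/\ w k1 k2 = \sum_(l1 < N1.+1) \sum_(l2 < N2.+1)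
                     cst (T k1 k2 l1 l2) * u l1 l2,
         w_bar k1 k2 = \sum_(l1 < N1.+1) \sum_(l2 < N2.+1)
                         cst (S k1 k2 l1 l2) * u l1 l2,
         w_bar k1 k2 = \sum_(l1 < N1.+1) \sum_(l2 < N2.+1)
                         cst (T_bar k1 k2 l1 l2) * u_bar l1 l2
       & w k1 k2 = \sum_(l1 < N1.+1) \sum_(l2 < N2.+1)
                     cst (S_bar k1 k2 l1 l2) * u_bar l1 l2].
Proof.
move=> A1 A2 B1 B2 A12 B12 A21 B21 u v w u_bar v_bar w_bar T S T_bar S_bar.
split; last split; last exact: overlap_expansions.
- split; [exact: joint_eigenbasis_u|exact: joint_eigenbasis_v|exact: joint_eigenbasis_w].
- split; [exact: joint_eigenbasis_u_bar|exact: joint_eigenbasis_v_bar|].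
  exact: joint_eigenbasis_w_bar.
Qed.
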